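(* There is a polynomial time algorithm that, given any input $(m,U)$ to the Bike Sharing problem, i.e. integers $m\ge 1$, $0\le b\le m$ and a multiset $U=\{u_1\le u_2\le\dots\le u_b\}\subset(0,1)$ of inverse bike speeds, constructs an arrival-time optimal schedule for the Bike Sharing problem: a feasible schedule $(X,M)$ in which every bike makes it to the end and such that $\tau(X,M)\le\tau(X',M')$ for every feasible schedule $(X',M')$ in which every bike makes it to the end.
   Context: There are $m$ agents and $b$ bikes, all starting at the point $0$ of the interval $[0,1]$. Bike $k$ has inverse speed $u_k$; label $0$ denotes walking, with inverse speed $1$. A schedule of size $n$ is a pair $(X,M)$, where $X=(x_1,\dots,x_n)$ satisfies $x_j\ge 0$ and $\sum_j x_j=1$ (consecutive subintervals of $[0,1]$ and their lengths), and $M$ is an $m\times n$ matrix with entries in $\{0,1,\dots,b\}$; $M(i,j)$ is the label of the bike used by agent $i$ on subinterval $x_j$ ($0$ if agent $i$ walks). Let $\widetilde M(i,j)=u_{M(i,j)}$ if $M(i,j)\ne 0$ and $\widetilde M(i,j)=1$ if $M(i,j)=0$. Put $t_{i,j}=\sum_{k=1}^{j}\widetilde M(i,k)x_k$, $t_i=t_{i,n}$ (arrival time of agent $i$), and $\tau(X,M)=\max_i t_i$. $(X,M)$ is feasible if: (1) for $j\ge2$, $M(i,j)\ne0$ implies there is $i'$ with $M(i',j-1)=M(i,j)$; (2) $M(i,j)\ne 0$ implies $M(i',j)\ne M(i,j)$ for all $i'\ne i$; (3) for $j\ge 2$, $M(i,j)=M(i',j-1)\neq0$ implies $t_{i',j-1}\le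 t_{i,j-1}$. Bike $k$ makes it to the end if $M(i,n)=k$ for some $i$. The Bike Sharing problem asks, given $(m,U)$, for a feasible schedule in which every bike makes it to the end, minimizing $\tau(X,M)$. *)

(* Defs.v *)
From HB Require Import structures.
From mathcomp Require Import all_boot all_order all_algebra.
From mathcomp Require Import reals.

Set Implicit Arguments.
Unset Strict Implicit.
Unset Printing Implicit Defensive.

Import Order.TTheory GRing.Theory Num.Theory.
Local Open Scope ring_scope.

(** * The Bike Sharing problem *)

Section BikeSharing.
Variables (R : realFieldType) (m b : nat).

(* The multiset U is listed in nondecreasing order: u_1, ..., u_b are the
   entries 0, ..., b-1 of the tuple. *)
Definition valid_speeds (u : b.-tuple R) : Prop :=
  sorted <=%R u /\ forall k : 'I_b, 0 < tnth u k < 1.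

(* Labels live in 'I_b.+1: 0 is walking (inverse speed 1), k is bike k. *)
Definition inv_speed (u : b.-tuple R) (l : 'I_b.+1) : R :=
  tnth [tuple of 1 :: u] l.

(* Rows are agents, columns are subintervals; both are numbered from 0. *)
Record schedule : Type := Schedule {
  ssize : nat;
  slen : 'rV[R]_ssize;
  slab : 'M['I_b.+1]_(m, ssize) }.

Definition is_schedule (S : schedule) : Prop :=
  (forall j, 0 <= slen S 0 j) /\ \sum_j slen S 0 j = 1.

Variable u : b.-tuple R.

(* The time at which agent i completes subinterval j. *)
Definition time_at (S : schedule) (i : 'I_m) (j : 'I_(ssize S)) : R :=
  \sum_(k < ssize S | (k <= j)%N) inv_speed u (slab S i k) * slen S 0 k.

Definition arrival (S : schedule) (i : 'I_m) : R :=
  \sum_(k < ssize S) inv_speed u (slab S i k) * slen S 0 k.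

(* Arrival times are nonnegative, so the base value 0 of the maximum is
   harmless when m > 0. *)
Definition tau (S : schedule) : R := \big[Num.max/0]_(i < m) arrival S i.

(* In the first and third clauses j' stands for j - 1. *)
Definition feasible (S : schedule) : Prop :=
  [/\ forall (i : 'I_m) (j' j : 'I_(ssize S)), j = j'.+1 :> nat ->
        slab S i j != ord0 -> exists i' : 'I_m, slab S i' j' = slab S i j,
      forall (i i' : 'I_m) (j : 'I_(ssize S)),
        slab S i j != ord0 -> i' != i -> slab S i' j != slab S i j &
      forall (i i' : 'I_m) (j' j : 'I_(ssize S)), j = j'.+1 :> nat ->
        slab S i j = slab S i' j' -> slab S i j != ord0 ->
        time_at i' j' <= time_at i j'].

Definition makes_it_to_end (S : schedule) (k : 'I_b.+1) : Prop :=
  exists (i : 'I_m) (j : 'I_(ssize S)), j.+1 = ssize S /\ slab S i j = k.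

Definition bike_sharing_solution (S : schedule) : Prop :=
  [/\ is_schedule S, feasible S &
      forall k : 'I_b.+1, k != ord0 -> makes_it_to_end S k].

Definition arrival_time_optimal (S : schedule) : Prop :=
  bike_sharing_solution S /\
  forall S' : schedule, bike_sharing_solution S' -> tau S <= tau S'.

End BikeSharing.

(** * A random access machine over an ordered field *)

(* A random access machine with two unbounded memories, one of natural numbers
   and one of field elements, both addressed (possibly indirectly) by natural
   numbers.  Its programs are finite and do not depend on the input.  Field
   elements can only be combined by the field operations (with x / 0 = 0),
   compared, and created from natural numbers; in particular there is no
   rounding.

   The cost of an expression is the sum of the sizes of the values of all its
   subexpressions, natural numbers always being charged their binary length
   (so that addresses are charged too).  Field elements are charged by a
   parameter [sz], which is instantiated in two ways:
   - [sz x = 1]: the real RAM, with unit cost arithmetic on real numbers;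
   - [sz = rat_bits] on rationals: the logarithmic cost RAM, which is
     polynomially equivalent to Turing machines.
   The cost of an operation thus covers the sizes of its operands and of its
   result, so that its bit complexity is polynomial in its cost. *)

Definition nat_bits (n : nat) : nat := (trunc_log 2 n).+1.

Definition rat_bits (q : rat) : nat :=
  (nat_bits `|numq q| + nat_bits `|denq q|)%N.

Inductive iexp : Type :=
  | ICst of nat
  | IGet of iexp                (* contents of the integer cell at an address *)
  | IAdd of iexp & iexp
  | ISub of iexp & iexp         (* truncated subtraction *)
  | IMul of iexp & iexp.

Inductive fexp : Type :=
  | FNat of iexp
  | FGet of iexp                (* contents of the field cell at an address *)
  | FAdd of fexp & fexp
  | FSub of fexp & fexp
  | FMul of fexp & fexp
  | FDiv of fexp & fexp.

Inductive bexp : Type :=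
  | BIle of iexp & iexp
  | BFle of fexp & fexp
  | BNot of bexp
  | BAnd of bexp & bexp.

Inductive cmd : Type :=
  | Skip
  | ISet of iexp & iexp         (* address, value *)
  | FSet of iexp & fexp         (* address, value *)
  | Seq of cmd & cmd
  | If of bexp & cmd & cmd
  | While of bexp & cmd.

Section Machine.
Variables (F : realFieldType) (sz : F -> nat).

Record state : Type := State { imem : nat -> nat; fmem : nat -> F }.

Definition upd (T : Type) (f : nat -> T) (a : nat) (v : T) : nat -> T :=
  fun k => if k == a then v else f k.

Fixpoint ieval (s : state) (e : iexp) : nat :=
  match e with
  | ICst n => n
  | IGet a => imem s (ieval s a)
  | IAdd e1 e2 => (ieval s e1 + ieval s e2)%N
  | ISub e1 e2 => (ieval s e1 - ieval s e2)%N
  | IMul e1 e2 => (ieval s e1 * ieval s e2)%N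
  end.

Fixpoint icost (s : state) (e : iexp) : nat :=
  (nat_bits (ieval s e) +
   match e with
   | ICst _ => 0
   | IGet a => icost s a
   | IAdd e1 e2 | ISub e1 e2 | IMul e1 e2 => icost s e1 + icost s e2
   end)%N.

Fixpoint feval (s : state) (e : fexp) : F :=
  match e with
  | FNat a => (ieval s a)%:R
  | FGet a => fmem s (ieval s a)
  | FAdd e1 e2 => feval s e1 + feval s e2
  | FSub e1 e2 => feval s e1 - feval s e2
  | FMul e1 e2 => feval s e1 * feval s e2
  | FDiv e1 e2 => feval s e1 / feval s e2
  end.

Fixpoint fcost (s : state) (e : fexp) : nat :=
  (sz (feval s e) +
   match e with
   | FNat a | FGet a => icost s a
   | FAdd e1 e2 | FSub e1 e2 | FMul e1 e2 | FDiv e1 e2 =>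
       fcost s e1 + fcost s e2
   end)%N.

Fixpoint beval (s : state) (e : bexp) : bool :=
  match e with
  | BIle e1 e2 => (ieval s e1 <= ieval s e2)%N
  | BFle e1 e2 => feval s e1 <= feval s e2
  | BNot e1 => ~~ beval s e1
  | BAnd e1 e2 => beval s e1 && beval s e2
  end.

Fixpoint bcost (s : state) (e : bexp) : nat :=
  match e with
  | BIle e1 e2 => (icost s e1 + icost s e2).+1
  | BFle e1 e2 => (fcost s e1 + fcost s e2).+1
  | BNot e1 => (bcost s e1).+1
  | BAnd e1 e2 => (bcost s e1 + bcost s e2).+1
  end.

(* [exec c s t s']: from state [s], the program [c] terminates in state [s']
   at total cost [t].  The relation is deterministic in [t] and [s']. *)
Inductive exec : cmd -> state -> nat -> state -> Prop :=
  | ExecSkip s : exec Skip s 1 s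
  | ExecISet s a e :
      exec (ISet a e) s (icost s a + icost s e).+1
        (State (upd (imem s) (ieval s a) (ieval s e)) (fmem s))
  | ExecFSet s a e :
      exec (FSet a e) s (icost s a + fcost s e).+1
        (State (imem s) (upd (fmem s) (ieval s a) (feval s e)))
  | ExecSeq s1 s2 s3 c1 c2 t1 t2 :
      exec c1 s1 t1 s2 -> exec c2 s2 t2 s3 ->
      exec (Seq c1 c2) s1 (t1 + t2) s3
  | ExecIf s s' e c1 c2 t :
      exec (if beval s e then c1 else c2) s t s' ->
      exec (If e c1 c2) s (bcost s e + t) s'
  | ExecWhileEnd s e c :
      ~~ beval s e -> exec (While e c) s (bcost s e) s
  | ExecWhileStep s1 s2 s3 e c t1 t2 :
      beval s1 e -> exec c s1 t1 s2 -> exec (While e c) s2 t2 s3 ->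
      exec (While e c) s1 (bcost s1 e + t1 + t2) s3.

(* The input (m, U): integer cells 0 and 1 hold m and b, field cells
   0, ..., b-1 hold u_1, ..., u_b, and all other cells hold 0. *)
Definition init_state (m b : nat) (u : b.-tuple F) : state :=
  State (nth 0%N [:: m; b]) (nth 0 u).

(* m is counted in unary: any output has at least m entries, and b <= m. *)
Definition input_size (m b : nat) (u : b.-tuple F) : nat :=
  (m + \sum_(k < b) sz (tnth u k))%N.

End Machine.

(* The final state [s] describes the schedule [S] of size n, the field elements
   being read through [f]: integer cell 0 holds n, integer cells 1, ..., m * n
   hold the matrix row by row, and field cells 0, ..., n-1 hold the lengths. *)
Definition describes (F : realFieldType) (R : realFieldType) (f : F -> R)
    (m b : nat) (s : state F) (S : schedule R m b) : Prop :=
  [/\ imem s 0 = ssize S,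
      forall (i : 'I_m) (j : 'I_(ssize S)),
        imem s (1 + i * ssize S + j)%N = slab S i j :> nat &
      forall j : 'I_(ssize S), f (fmem s j) = slen S 0 j].

(* On input (m, u), the program [P] computes, within the time bound [p], a
   schedule that is arrival-time optimal among all schedules over [R], where
   the numbers [F] of the machine are regarded as elements of [R] through
   [f].  The number of entries of the output matrix is added to the running
   time, since memory cells that are never written also count as output. *)
Definition solves_within (F : realFieldType) (sz : F -> nat)
    (R : realFieldType) (f : F -> R) (P : cmd) (p : {poly nat})
    (m b : nat) (u : b.-tuple F) : Prop :=
  exists (t : nat) (s : state F) (S : schedule R m b),
    [/\ exec sz P (init_state m u) t s,
        (t + m * ssize S <= p.[input_size sz m u])%N,
        describes f s S &
        arrival_time_optimal (map_tuple f u) S].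

(* Main.v *)
Require Import Defs.
From mathcomp Require Import all_boot all_order all_algebra.
From mathcomp Require Import reals.
From mathcomp Require Import zify ring lra.

Set Implicit Arguments.
Unset Strict Implicit.
Unset Printing Implicit Defensive.

Import Order.TTheory GRing.Theory Num.Theory.
Local Open Scope ring_scope.

(* Write a_k for 1 minus the inverse speed of bike k, the bikes being sorted
   slowest first, and A for the sum of the a_k.  In a solution every bike is used
   in every column, so the agents save A in total compared with walking, and no
   solution beats 1 - A / m or the inverse speed of the slowest bike.

   To reach the maximum of these bounds, lay the bikes side by side as segments
   of lengths a_k and cut the resulting line into one piece per agent, as in
   McNaughton's wrap-around rule.  As long as the slowest remaining bike is
   shorter than the mean remaining saving, its rider keeps it all the way; the
   rest of the line is cut into pieces of equal length D, and then D <= a_k for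
   all remaining bikes.  A point of the line is a bike together with a position
   in [0, 1], and the owner of the piece containing it rides that bike there.
   D <= a_k implies that an agent is never on two bikes at the same position and
   that a bike is only ever handed over to a later agent.  The positions of the
   cuts are the break points of the schedule. *)

(** * Lower bounds *)

(** A length on the line is an amount of time saved, so the owner of a piece of length d arrives at
    1 - d. If [nsolo] is 0, all pieces equal A / m; otherwise no piece is shorter than the slowest
    bike. Either way one of the two lower bounds is met. The delicate condition is that a bike must
    be dropped before it is picked up. It is checked by comparing savings at the handover. The
    definitions are phrased in machine operations (truncated subtraction, tests by <=, variables
    overwritten in loops), so that the program invariants are their unfoldings. Bit size is a
    separate obstacle: only the prefix sums accumulate over a loop; all other values are fixed
    expressions in them or are selected by comparisons. The machine may compute with rationals while
    competing with all real schedules, so the lower bounds hold over any ordered field and the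
    schedule is transported along an order embedding. *)

Section LowerBounds.
Variables (R : realFieldType) (m b : nat) (u : b.-tuple R).

Lemma inv_speed_lift (k : 'I_b) : inv_speed u (lift ord0 k) = tnth u k.
Proof. by rewrite /inv_speed !(tnth_nth 0). Qed.

Lemma inv_speed0 : inv_speed u ord0 = 1.
Proof. by rewrite /inv_speed (tnth_nth 0). Qed.

Lemma arrival_le_tau (S : schedule R m b) (i : 'I_m) : @arrival R m b u S i <= tau u S.
Proof. by rewrite /tau (bigD1 i) //= le_max lexx. Qed.

Lemma tau_le (S : schedule R m b) (x : R) :
  0 <= x -> (forall i : 'I_m, @arrival R m b u S i <= x) -> tau u S <= x.
Proof.
move=> x0 h; rewrite /tau; elim/big_ind: _ => // y z hy hz.
by rewrite ge_max hy hz.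
Qed.

(** Column by column: by condition (2) each bike has at most one rider, so a column of length x
    saves at most x times the sum of the [1 - tnth u k]; an idle bike fits the bound because these
    numbers are nonnegative. The mean arrival time is then bounded, hence the maximum. *)
Lemma tau_ge_mean (S : schedule R m b) :
  (forall k : 'I_b, tnth u k <= 1) -> is_schedule S -> feasible u S ->
  m%:R - \sum_(k < b) (1 - tnth u k) <= m%:R * tau u S.
Proof.
move=> u1 [x0 x1] [_ inj _].
apply: (@le_trans _ _ (\sum_(i < m) @arrival R m b u S i)); last first.
  rewrite mulr_natl -[X in _ *+ X]card_ord -sumr_const.
  by apply: ler_sum => i _; exact: arrival_le_tau.
rewrite /arrival exchange_big /=.
rewrite -[leLHS]mulr1 -[X in _ * X <= _]x1 mulr_sumr; apply: ler_sum => j _.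
rewrite -mulr_suml; apply: ler_wpM2r => //.
have -> : \sum_(i < m) inv_speed u (slab S i j) =
    m%:R - \sum_(i < m) (1 - inv_speed u (slab S i j)).
  by rewrite sumrB sumr_const card_ord subKr.
rewrite lerD2l lerN2.
rewrite (partition_big (fun i => slab S i j) xpredT) //= big_ord_recl.
rewrite big1 ?add0r => [|i /eqP ->]; last by rewrite inv_speed0 subrr.
apply: ler_sum => k _.
rewrite (eq_bigr (fun=> 1 - tnth u k)) => [|i /eqP ->]; last first.
  by rewrite inv_speed_lift.
have [i0 /eqP hi0|none] := pickP (fun i => slab S i j == lift ord0 k).
  rewrite (big_pred1 i0) // => i; apply/eqP/eqP => [hi|-> //].
  apply/eqP/negPn/negP => ne; move/eqP: hi; apply/negP; rewrite -hi0.
  by apply: inj => //; rewrite hi0.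
by rewrite big_pred0 // subr_ge0.
Qed.

(** Backward induction from the last column: condition (1) provides a rider one column to the
    left. *)
Lemma bike_in_every_column (S : schedule R m b) (k : 'I_b.+1) :
  feasible u S -> k != ord0 -> makes_it_to_end S k ->
  forall j : 'I_(ssize S), exists i : 'I_m, slab S i j = k.
Proof.
move=> [prev _ _] k0 [i0 [j0 [last hi0]]] j.
have [d] := ubnP (j0 - j); elim: d j => // d IH j hd.
have [e|ne] := eqVneq (j : nat) j0.
  by exists i0; rewrite -hi0; congr (slab S _ _); apply: val_inj.
have jlt : (j.+1 < ssize S)%N by have := ltn_ord j; lia.
have [|i hi] := IH (Ordinal jlt); first by rewrite /=; lia.
have [|i' hi'] := prev i j (Ordinal jlt) erefl; first by rewrite hi.
by exists i'; rewrite hi'.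
Qed.

Lemma time_atS (S : schedule R m b) (i : 'I_m) (j' j : 'I_(ssize S)) :
  j = j'.+1 :> nat ->
  time_at u i j = time_at u i j' + inv_speed u (slab S i j) * slen S 0 j.
Proof.
move=> e; rewrite /time_at (bigD1 j) //= addrC; congr (_ + _).
apply: eq_bigl => l; rewrite -(inj_eq val_inj) /= e.
by rewrite andbC -ltn_neqAle ltnS.
Qed.

(** A bike cannot gain time by changing hands: by condition (3) the new rider starts no earlier than
    the previous one arrived. The induction [bound] follows the bike through the columns. *)
Lemma tau_ge_bike (S : schedule R m b) (k : 'I_b) :
  bike_sharing_solution u S -> tnth u k <= tau u S.
Proof.
move=> [[x0 x1] feas ends].
have kn0 : lift ord0 k != ord0 by [].
have col := bike_in_every_column feas kn0 (ends _ kn0).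
have [_ _ hand] := feas.
have bound : forall n (j : 'I_(ssize S)) i, j = n :> nat ->
    slab S i j = lift ord0 k ->
    tnth u k * (\sum_(l < ssize S | (l <= j)%N) slen S 0 l) <= time_at u i j.
  elim=> [|n IH] j i ej hi.
    have e1 : forall l : 'I_(ssize S), (l <= j)%N = (l == j).
      by move=> l; rewrite -(inj_eq val_inj) /= ej leqn0.
    rewrite /time_at !(eq_bigl _ _ e1) !big_pred1_eq hi.
    by rewrite inv_speed_lift.
  have jlt : (n < ssize S)%N by have := ltn_ord j; lia.
  have ej' : j = (Ordinal jlt).+1 :> nat by rewrite ej.
  have [i' hi'] := col (Ordinal jlt).
  have := IH (Ordinal jlt) i' erefl hi'.
  have : time_at u i' (Ordinal jlt) <= time_at u i (Ordinal jlt).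
    by apply: (hand _ _ _ j); rewrite ?hi ?hi'.
  move=> /[swap] /le_trans /[apply] h.
  rewrite (time_atS _ ej') hi inv_speed_lift.
  have -> : \sum_(l < ssize S | (l <= j)%N) slen S 0 l =
      \sum_(l < ssize S | (l <= n)%N) slen S 0 l + slen S 0 j.
    rewrite (bigD1 j) //= addrC; congr (_ + _); apply: eq_bigl => l.
    by rewrite -(inj_eq val_inj) /= ej andbC -ltn_neqAle ltnS.
  by rewrite mulrDr lerD2r.
have [i [j [last hi]]] := ends _ kn0.
have all_le : forall l : 'I_(ssize S), (l <= j)%N = true.
  by move=> l; have := ltn_ord l; lia.
have := bound _ j i erefl hi.
rewrite /time_at !(eq_bigl _ _ all_le) x1 mulr1 => /le_trans; apply.
exact: arrival_le_tau.
Qed.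
End LowerBounds.

(** * The wrap-around schedule *)

(** Models a variable initialised to [d] and overwritten by [v k] in the rounds [k = 0, ..., n - 1]
    of a loop that satisfy [p k]. One unfolding is one round, so [last_val k] is the loop
    invariant. *)
Fixpoint last_val (T : Type) (n : nat) (p : pred nat) (v : nat -> T) (d : T) : T :=
  if n is n'.+1 then if p n' then v n' else last_val n' p v d else d.

Variant last_val_spec (T : Type) n (p : pred nat) (v : nat -> T) d : T -> Prop :=
  | LastVal k of (k < n)%N & p k & (forall l, (k < l < n)%N -> ~~ p l) :
      last_val_spec n p v d (v k)
  | LastDefault of (forall l, (l < n)%N -> ~~ p l) : last_val_spec n p v d d.

Lemma last_valP (T : Type) n p (v : nat -> T) d :
  last_val_spec n p v d (last_val n p v d).
Proof.
elim: n => [|n IH] /=; first by right.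
case pn: (p n); first by left=> // l; lia.
case: IH => [k kn pk kl|none].
  left=> // [|l /andP[kl']]; first by lia.
  rewrite ltnS leq_eqVlt => /orP[/eqP ->|ln]; first by rewrite pn.
  by apply: kl; rewrite kl'.
right=> l; rewrite ltnS leq_eqVlt => /orP[/eqP ->|]; first by rewrite pn.
exact: none.
Qed.

(** Differences of clamped values measure how much of an interval lies in [[lo, hi]]. *)
Definition clamp (R : realFieldType) (lo hi x : R) := Num.max lo (Num.min hi x).

Section Clamp.
Variables (R : realFieldType) (lo hi : R).
Hypothesis lohi : lo <= hi.

Lemma clamp_lo x : x <= lo -> clamp lo hi x = lo.
Proof. by move=> h; rewrite /clamp (min_r (le_trans h lohi)) max_l. Qed.

Lemma clamp_hi x : hi <= x -> clamp lo hi x = hi.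
Proof. by move=> h; rewrite /clamp min_l // max_r. Qed.

Lemma clamp_id x : lo <= x <= hi -> clamp lo hi x = x.
Proof. by move=> /andP[h1 h2]; rewrite /clamp min_r // max_r. Qed.

Lemma clamp_homo x y : x <= y -> clamp lo hi x <= clamp lo hi y.
Proof.
move=> xy; rewrite /clamp ge_max le_max lexx /= le_max; apply/orP; right.
by rewrite le_min !ge_min lexx xy orbT.
Qed.
End Clamp.

Section Algorithm.
Variables (F : realFieldType) (m b : nat) (w : nat -> F).

(** The input lists the fastest bike first; the index [b - 1 - k] reverses it, which makes [save]
    nondecreasing. *)
Definition save (k : nat) : F := 1 - w (b - 1 - k).
Definition psave (n : nat) : F := \sum_(k < n) save k.

(** The test says that bike [k] is shorter than the mean of what remains for [m - k] agents. For
    sorted savings, a success at one index implies success at all smaller ones, so the last success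
    ends the initial run; [succn] turns its index into a count. *)
Definition nsolo : nat :=
  last_val b (fun k => ~~ (psave b - psave k <=
                           (psave k.+1 - psave k) * (m - k)%:R)) succn 0%N.

(** With truncated subtraction, [i - (i - nsolo)] is the minimum of [i] and [nsolo]. Machine
    expressions cannot branch, and this single formula covers both solo and shared pieces. *)
Definition cut (i : nat) : F :=
  psave (i - (i - nsolo)) +
  (i - nsolo)%:R * (psave b - psave nsolo) / (m - nsolo)%:R.

(** The half-open test singles out the bike whose segment contains the cut. None qualifies when the
    cut is the right end of the line; the default 0 then adds no new break point. *)
Definition cutpos (i : nat) : F :=
  last_val b (fun k => (psave k <= cut i) && ~~ (psave k.+1 <= cut i))
    (fun k => (cut i - psave k) / (psave k.+1 - psave k)) 0.

Fixpoint max_below (q : F) (n : nat) : F :=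
  if n is n'.+1 then
    let x := max_below q n' in
    if ~~ (q <= cutpos n') && ~~ (cutpos n' <= x) then cutpos n' else x
  else 0.

(** Walking left from 1, always to the largest cut position strictly below, sorts the positions and
    removes duplicates at once. When the positive ones are used up the value stays 0, so the missing
    columns are empty and their number is always [m]. *)
Fixpoint brk_from_end (t : nat) : F :=
  if t is t'.+1 then max_below (brk_from_end t') m else 1.

Definition brk (j : nat) : F := brk_from_end (m - j).

Definition pt (k j : nat) : F := psave k + brk j * (psave k.+1 - psave k).

(** Bike [k], counted from the slowest, has index [b - 1 - k] in [w]; its label is one more because
    label 0 is walking. *)
Definition bike_at (i j : nat) : nat :=
  last_val b (fun k => (cut i <= pt k j) && ~~ (cut i.+1 <= pt k j))
    (fun k => (b - k)%N) 0%N.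

Definition collen (j : nat) : F := brk j.+1 - brk j.

Hypotheses (m_gt0 : (0 < m)%N) (b_le_m : (b <= m)%N).
Hypothesis w01 : forall k, (k < b)%N -> 0 < w k < 1.
Hypothesis w_homo : forall k l, (k <= l < b)%N -> w k <= w l.

Definition share : F := (psave b - psave nsolo) / (m - nsolo)%:R.

(** * Prefix sums and the solo threshold *)

Lemma psave0 : psave 0 = 0.
Proof. by rewrite /psave big_ord0. Qed.

Lemma psaveS k : psave k.+1 = psave k + save k.
Proof. by rewrite /psave big_ord_recr. Qed.

Lemma psaveB k : psave k.+1 - psave k = save k.
Proof. by rewrite psaveS addrC addKr. Qed.

Lemma save_bounds k : (k < b)%N -> 0 < save k < 1.
Proof.
move=> kb; rewrite /save; have /andP[] : 0 < w (b - 1 - k)%N < 1 by apply: w01; lia.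
by move=> h1 h2; rewrite subr_gt0 h2 ltrBlDr ltrDl.
Qed.

Lemma save_gt0 k : (k < b)%N -> 0 < save k.
Proof. by move/save_bounds/andP => []. Qed.

Lemma save_homo k l : (k <= l < b)%N -> save k <= save l.
Proof.
by move=> h; rewrite /save lerD2l lerN2; apply: w_homo; lia.
Qed.

Lemma psave_lt k l : (k < l <= b)%N -> psave k < psave l.
Proof.
elim: l => // l IH /andP[kl lb]; rewrite psaveS.
have sl := save_gt0 lb.
have [->|ne] := eqVneq k l; first by rewrite ltrDl.
apply: lt_trans (_ : psave l < _); last by rewrite ltrDl.
by apply: IH; lia.
Qed.

Lemma psave_le k l : (k <= l <= b)%N -> psave k <= psave l.
Proof.
move=> /andP[]; rewrite leq_eqVlt => /orP[/eqP -> //|kl lb].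
by apply/ltW/psave_lt; rewrite kl.
Qed.

Lemma psave_ltW k l : (k <= b)%N -> (l <= b)%N -> psave k < psave l -> (k < l)%N.
Proof.
move=> kb lb; rewrite ltnNge ltNge; apply: contra => lk.
by apply: psave_le; rewrite lk.
Qed.

(** A success of the test at [k = m - 1] would force [b = m] and compare the last saving strictly
    with itself. The bound makes the denominator of [share] positive. *)
Lemma nsolo_lt : (nsolo < m)%N.
Proof.
rewrite /nsolo; case: last_valP => [k kb|] //.
rewrite psaveB -ltNge => h _.
rewrite ltn_neqAle; apply/andP; split; last by lia.
apply/negP => /eqP e; have eb : b = k.+1 by lia.
by move: h; rewrite eb -e psaveB subSn // subnn mulr1 ltxx.
Qed.

Lemma nsolo_le : (nsolo <= b)%N.
Proof. by rewrite /nsolo; case: last_valP. Qed.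

Let rest_gt0 : 0 < (m - nsolo)%:R :> F.
Proof. by rewrite ltr0n subn_gt0 nsolo_lt. Qed.

Lemma share_ge0 : 0 <= share.
Proof.
apply: divr_ge0; last exact: ltW.
by rewrite subr_ge0 psave_le // nsolo_le leqnn.
Qed.

(** The last success lies before index [nsolo], so the test fails there, which is the claim for
    [k = nsolo]; later savings are no smaller. *)
Lemma share_le_save k : (nsolo <= k < b)%N -> share <= save k.
Proof.
move=> /andP[rk kb]; apply: (@le_trans _ _ (save nsolo)); last first.
  by apply: save_homo; rewrite rk.
have rb : (nsolo < b)%N by lia.
rewrite /share ler_pdivrMr //; move: rb; rewrite /nsolo.
case: last_valP => [l lb _ max_l rb|none b0].
  by have := max_l l.+1; rewrite negbK psaveB; apply; lia.
by have := none 0%N b0; rewrite negbK psaveB.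
Qed.

(** At the last success [l], cancelling one copy of [save l] turns the comparison over [m - l]
    agents into one over the [m - l - 1] agents that share. *)
Lemma save_le_share i : (i < nsolo)%N -> save i <= share.
Proof.
move=> ir; have rest0 := rest_gt0; rewrite /share ler_pdivlMr //.
have rm := nsolo_lt.
move: ir rest0 rm; rewrite /nsolo; case: last_valP => [l lb|] //.
rewrite psaveB -ltNge => h _ il rest0 rm.
have : save l * (m - l.+1)%:R < psave b - psave l.+1.
  move: h; rewrite psaveS (_ : (m - l)%N = (m - l.+1).+1); last by lia.
  by rewrite -natr1 mulrDr mulr1; lra.
move/ltW; apply: le_trans; apply: ler_wpM2r; first exact: ltW.
by apply: save_homo; lia.
Qed.

(** * Cuts and their positions *)

Lemma cut_solo i : (i <= nsolo)%N -> cut i = psave i.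
Proof.
by rewrite /cut -subn_eq0 => /eqP ->; rewrite subn0 !mul0r addr0.
Qed.

Lemma cut_shared i : (nsolo <= i)%N ->
  cut i = psave nsolo + (i - nsolo)%:R * share.
Proof. by move=> h; rewrite /cut subKn // -mulrA. Qed.

Lemma cutS_solo i : (i < nsolo)%N -> cut i.+1 = cut i + save i.
Proof. by move=> h; rewrite !cut_solo ?psaveS // ltnW. Qed.

Lemma cutS_shared i : (nsolo <= i)%N -> cut i.+1 = cut i + share.
Proof.
move=> h; rewrite !cut_shared ?(leqW h) // subSn // -natr1 mulrDl mul1r.
by rewrite addrA.
Qed.

Lemma cut0 : cut 0 = 0.
Proof. by rewrite cut_solo // psave0. Qed.

Lemma cut_m : cut m = psave b.
Proof.
rewrite cut_shared; last exact/ltnW/nsolo_lt.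
by rewrite /share mulrC divfK ?gt_eqF // addrC subrK.
Qed.

Lemma cut_leS i : cut i <= cut i.+1.
Proof.
case: (leqP nsolo i) => h; first by rewrite cutS_shared // lerDl share_ge0.
rewrite cutS_solo // lerDl ltW // save_gt0 //.
exact: leq_trans h nsolo_le.
Qed.

Lemma cut_homo i j : (i <= j)%N -> cut i <= cut j.
Proof.
elim: j => [|j IH]; first by rewrite leqn0 => /eqP ->.
rewrite leq_eqVlt => /orP[/eqP -> //|]; rewrite ltnS => /IH h.
exact: le_trans h (cut_leS j).
Qed.

Lemma cut_ge0 i : 0 <= cut i.
Proof. by rewrite -cut0 cut_homo. Qed.

Lemma cutpos_bounds i : 0 <= cutpos i < 1.
Proof.
rewrite /cutpos; case: last_valP => [k kb /andP[h1]|]; last by rewrite lexx ltr01.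
rewrite -ltNge psaveB psaveS => h2 _; have s0 := save_gt0 kb.
apply/andP; split; last by rewrite ltr_pdivrMr // mul1r; lra.
by apply: divr_ge0; [lra | exact: ltW].
Qed.

Lemma cutposE i k : (k < b)%N -> psave k <= cut i < psave k.+1 ->
  cutpos i * save k = cut i - psave k.
Proof.
move=> kb /andP[h1 h2]; rewrite /cutpos; case: last_valP => [l lb|none].
  rewrite -ltNge => /andP[h3 h4] _; suff -> : l = k.
    by rewrite psaveB divfK // gt_eqF // save_gt0.
  apply/eqP; rewrite eqn_leq; apply/andP; split; rewrite -ltnS.
    by apply: psave_ltW; [lia | lia | exact: le_lt_trans h3 h2].
  by apply: psave_ltW; [lia | lia | exact: le_lt_trans h1 h4].
by have := none k kb; rewrite h1 -ltNge h2.
Qed.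

Lemma cutpos0 : cutpos 0 = 0.
Proof.
have [b0|b0] := posnP b; first by rewrite /cutpos b0.
have s0 := save_gt0 b0.
have : cutpos 0 * save 0 = 0.
  by rewrite cutposE // psave0 cut0 ?subr0 // lexx psaveS psave0 add0r.
by move/eqP; rewrite mulf_eq0 (gt_eqF s0) orbF => /eqP.
Qed.

(** * Break points *)

Lemma max_below_ge0 q n : 0 <= max_below q n.
Proof.
elim: n => //= n IH; case: ifP => // _.
by have /andP[] := cutpos_bounds n.
Qed.

Lemma max_below_lt1 q n : max_below q n < 1.
Proof.
elim: n => //= n IH; case: ifP => // _.
by have /andP[] := cutpos_bounds n.
Qed.

Lemma max_below_lt q n : 0 < q -> max_below q n < q.
Proof.
by move=> q0; elim: n => //= n IH; case: ifP => // /andP[]; rewrite -ltNge.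
Qed.

Lemma max_below0 n : max_below 0 n = 0.
Proof.
elim: n => //= n ->.
by have /andP[-> _] := cutpos_bounds n.
Qed.

Lemma max_below_le q n : 0 <= q -> max_below q n <= q.
Proof.
rewrite le_eqVlt => /orP[/eqP <-|/max_below_lt h]; first by rewrite max_below0.
exact/ltW.
Qed.

Lemma max_below_ub q n i : (i < n)%N -> cutpos i < q -> cutpos i <= max_below q n.
Proof.
elim: n => // n IH; rewrite ltnS leq_eqVlt /= => /orP[/eqP ->|lt_in] iq.
  rewrite (_ : (q <= cutpos n) = false); last by rewrite leNgt iq.
  by case: (leP (cutpos n) (max_below q n)).
have h := IH lt_in iq; case: ifP => // /andP[_].
by rewrite -ltNge => /ltW; apply: le_trans.
Qed.

Lemma max_below_attained q n : (0 < n)%N -> 0 < q ->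
  exists2 i, (i < n)%N & max_below q n = cutpos i.
Proof.
move=> + q0; elim: n => // n IH _ /=.
case: ifP => [_|]; first by exists n.
have [n0 _|n0 _] := posnP n; first by exists 0%N; rewrite n0 //= cutpos0.
by have [i lt_in e] := IH n0; exists i => //; lia.
Qed.

Lemma brk_from_end_ge0 t : 0 <= brk_from_end t.
Proof. by case: t => [|t] /=; rewrite ?ler01 ?max_below_ge0. Qed.

Lemma brk_ge0 j : 0 <= brk j.
Proof. exact: brk_from_end_ge0. Qed.

Lemma brk_lt1 j : (j < m)%N -> brk j < 1.
Proof.
rewrite /brk -subn_gt0; case: (m - j)%N => //= t _; exact: max_below_lt1.
Qed.

Lemma brk_m : brk m = 1.
Proof. by rewrite /brk subnn. Qed.

Lemma brkE j : (j < m)%N -> brk j = max_below (brk j.+1) m.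
Proof. by move=> h; rewrite /brk (_ : m - j = (m - j.+1).+1)%N //; lia. Qed.

Lemma brk_leS j : (j < m)%N -> brk j <= brk j.+1.
Proof. by move=> h; rewrite (brkE h) max_below_le ?brk_ge0. Qed.

(* Each step towards the left strictly decreases the number of cut positions
   that are still to the left of the break point. *)
Lemma count_cutpos_lt_brk t :
  (#|[set i : 'I_m | (cutpos i < brk_from_end t)%R]| <= m - t)%N.
Proof.
elim: t => [|t IH]; first by rewrite subn0 -[X in (_ <= X)%N]card_ord max_card.
set q := brk_from_end t; have q0 : 0 <= q by apply: brk_from_end_ge0.
have [q00|q_n0] := eqVneq q 0.
  rewrite /= -/q q00 max_below0 (_ : [set i | _] = set0) ?cards0 //.
  apply/setP => i; rewrite !inE; apply/negbTE; rewrite -leNgt.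
  by have /andP[] := cutpos_bounds i.
have qgt0 : 0 < q by rewrite lt_def q_n0.
have [i im e] := max_below_attained m_gt0 qgt0.
suff : (#|[set i : 'I_m | (cutpos i < brk_from_end t.+1)%R]| <
        #|[set i : 'I_m | (cutpos i < q)%R]|)%N by move: IH; rewrite -/q; lia.
apply: proper_card; apply/properP; split.
  apply/subsetP => l; rewrite !inE => /lt_le_trans; apply.
  exact: max_below_le.
exists (Ordinal im); rewrite !inE /=; last by rewrite -/q e ltxx.
by rewrite -e max_below_lt.
Qed.

(** After [m] steps no cut position remains to the left of the break point, yet [cutpos 0 = 0] is
    one of them. *)
Lemma brk0 : brk 0 = 0.
Proof.
apply/eqP; rewrite eq_le brk_ge0 andbT leNgt; apply/negP => h.
have := count_cutpos_lt_brk m; rewrite subnn leqn0 cards_eq0.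
apply/negP/set0Pn; exists (Ordinal m_gt0); rewrite inE /= cutpos0.
by move: h; rewrite /brk subn0.
Qed.

(** * Owners of the points of the line *)

Definition at_pos (k : nat) (p : F) : F := psave k + p * save k.

Lemma ptE k j : pt k j = at_pos k (brk j).
Proof. by rewrite /pt psaveB. Qed.

Lemma at_pos0 k : at_pos k 0 = psave k.
Proof. by rewrite /at_pos mul0r addr0. Qed.

Lemma at_pos1 k : at_pos k 1 = psave k.+1.
Proof. by rewrite /at_pos mul1r psaveS. Qed.

Lemma at_pos_homo k p q : (k < b)%N -> p <= q -> at_pos k p <= at_pos k q.
Proof.
by move=> /save_gt0 s0 pq; rewrite /at_pos lerD2l ler_pM2r.
Qed.

Lemma at_pos_lt k p q : (k < b)%N -> (at_pos k p < at_pos k q) = (p < q).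
Proof. by move=> /save_gt0 s0; rewrite /at_pos ltrD2l ltr_pM2r. Qed.

(** A violating cut would lie on bike [k] at position [cutpos i], strictly between two consecutive
    break points, although [brk j] is the largest cut position below [brk j.+1]. Hence the owner of
    a bike is constant on a column. *)
Lemma no_cut_inside i k j : (i <= m)%N -> (k < b)%N -> (j < m)%N ->
  at_pos k (brk j) < cut i -> at_pos k (brk j.+1) <= cut i.
Proof.
move=> im kb jm h1; rewrite leNgt; apply/negP => h2.
have brk1 : brk j.+1 <= 1.
  have [e|ne] := eqVneq j.+1 m; first by rewrite e brk_m.
  by apply/ltW/brk_lt1; lia.
have s0 := save_gt0 kb.
have lo : psave k <= cut i.
  by apply/ltW/(le_lt_trans _ h1); rewrite -at_pos0 at_pos_homo ?brk_ge0.
have hi : cut i < psave k.+1.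
  by apply: (lt_le_trans h2); rewrite -at_pos1 at_pos_homo.
have lt_im : (i < m)%N.
  rewrite ltn_neqAle im andbT; apply/eqP => e; move: hi; rewrite e cut_m.
  by rewrite ltNge psave_le // kb leqnn.
have := cutposE kb; move/(_ i); rewrite lo hi => /(_ isT) e.
have e' : cut i = at_pos k (cutpos i) by rewrite /at_pos e addrC subrK.
move: h1 h2; rewrite e' !at_pos_lt // => h1 h2.
by have := max_below_ub lt_im h2; rewrite -brkE // leNgt h1.
Qed.

(** Points at the same position on consecutive bikes are [(1 - p) * save k + p * save k.+1] apart, a
    weighted mean of two savings. For a shared piece this is at least its length [share]; a solo
    piece ends with a bike not after [k]. *)
Lemma cut_window i k p : (i < m)%N -> (k.+1 < b)%N -> 0 <= p < 1 ->
  cut i <= at_pos k p -> cut i.+1 <= at_pos k.+1 p.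
Proof.
move=> im kb /andP[p0 p1] h; have kb' := ltnW kb.
have s0 := save_gt0 kb'; have s1 := save_gt0 kb.
have atS : at_pos k.+1 p = at_pos k p + (1 - p) * save k + p * save k.+1.
  by rewrite /at_pos psaveS; ring.
have lt : at_pos k p < psave k.+1 by rewrite -at_pos1 at_pos_lt.
have rb := nsolo_le.
case: (leqP nsolo i) => hi; last first.
  rewrite cut_solo //; apply: (@le_trans _ _ (psave k.+1)); last first.
    by rewrite -(at_pos0 k.+1) at_pos_homo.
  apply: psave_le; rewrite (ltnW kb) andbT.
  by apply: psave_ltW; [lia|lia|rewrite -cut_solo 1?ltnW //; exact: le_lt_trans h lt].
have rk : (nsolo <= k)%N.
  rewrite -ltnS; apply: psave_ltW => //.
  apply: le_lt_trans lt; apply: le_trans h.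
  by rewrite -cut_solo // cut_homo.
rewrite cutS_shared // atS.
have d0 : share <= save k by apply: share_le_save; rewrite rk.
have d1 : share <= save k.+1 by apply: share_le_save; lia.
have h1 : (1 - p) * share <= (1 - p) * save k by apply: ler_wpM2l => //; lra.
have h2 : p * share <= p * save k.+1 by apply: ler_wpM2l.
lra.
Qed.

Lemma cut_window_far i k l p : (i < m)%N -> (k < l < b)%N -> 0 <= p < 1 ->
  cut i <= at_pos k p -> cut i.+1 <= at_pos l p.
Proof.
move=> im /andP[kl lb] p01 h; have /andP[p0 p1] := p01.
apply: le_trans (_ : at_pos k.+1 p <= _); first by apply: cut_window => //; lia.
have [<- //|ne] := eqVneq k.+1 l.
apply: (@le_trans _ _ (psave k.+2)).
  by rewrite -at_pos1 at_pos_homo ?ltW //; lia.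
apply: (@le_trans _ _ (psave l)); first by apply: psave_le; lia.
by rewrite -{1}at_pos0 at_pos_homo.
Qed.

Definition rides (i k j : nat) : bool :=
  cut i <= at_pos k (brk j) < cut i.+1.

Lemma rides_inj_bike i k l j : (i < m)%N -> (j < m)%N -> (k < b)%N -> (l < b)%N ->
  rides i k j -> rides i l j -> k = l.
Proof.
move=> im jm + + ; wlog kl : k l / (k <= l)%N.
  move=> H kb lb rk rl; case: (leqP k l) => [|/ltnW] h; first exact: H.
  by apply/esym/H.
move=> kb lb /andP[k1 _] /andP[_ l2]; apply/eqP; rewrite eqn_leq kl /=.
rewrite leqNgt; apply/negP => lt; move: l2; apply/negP; rewrite -leNgt.
apply: (@cut_window_far i k) => //; first by rewrite lt.
by rewrite brk_ge0 brk_lt1.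
Qed.

(** A discrete intermediate value argument between [cut 0] and [cut m]. *)
Lemma rider_exists k j : (k < b)%N -> (j < m)%N ->
  exists2 i, (i < m)%N & rides i k j.
Proof.
move=> kb jm.
have h0 : cut 0 <= at_pos k (brk j).
  rewrite cut0 -psave0; apply: (@le_trans _ _ (psave k)); first by apply: psave_le; lia.
  by rewrite -at_pos0 at_pos_homo ?brk_ge0.
have hm : at_pos k (brk j) < cut m.
  apply: (@lt_le_trans _ _ (psave k.+1)); first by rewrite -at_pos1 at_pos_lt ?brk_lt1.
  by rewrite cut_m psave_le // kb leqnn.
suff : forall n, at_pos k (brk j) < cut n -> exists2 i, (i < n)%N & rides i k j.
  by move=> /(_ m hm).
elim=> [|n IH]; first by rewrite ltNge h0.
move=> hn; case: (leP (cut n) (at_pos k (brk j))) => [h|/IH [i lt_in hi]].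
  by exists n; rewrite ?ltnS // /rides h.
by exists i => //; apply: ltnW.
Qed.

Lemma rider_le i i' k l j : (k < b)%N -> at_pos k (brk j) <= at_pos k (brk l) ->
  rides i' k j -> rides i k l -> (i' <= i)%N.
Proof.
move=> kb le_jl /andP[h1 _] /andP[_ h2]; rewrite leqNgt; apply/negP => lt.
have := le_lt_trans (le_trans (cut_homo lt) h1) (le_lt_trans le_jl h2).
by rewrite ltxx.
Qed.

Lemma rider_inj i i' k j : (k < b)%N -> rides i k j -> rides i' k j -> i = i'.
Proof.
move=> kb h h'; have e := lexx (at_pos k (brk j)).
by apply/eqP; rewrite eqn_leq (rider_le kb e h h') (rider_le kb e h' h).
Qed.

Lemma bike_atP i j :
  (exists k, [/\ (k < b)%N, rides i k j & bike_at i j = (b - k)%N]) \/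
  ((forall k, (k < b)%N -> ~~ rides i k j) /\ bike_at i j = 0%N).
Proof.
rewrite /bike_at; case: last_valP => [k kb|none].
  by rewrite ptE -ltNge => h _; left; exists k.
by right; split=> // k /none; rewrite ptE -ltNge.
Qed.

Lemma bike_atE i k j : (i < m)%N -> (j < m)%N -> (k < b)%N ->
  rides i k j -> bike_at i j = (b - k)%N.
Proof.
move=> im jm kb h; case: (bike_atP i j) => [[l [lb hl ->]]|[none _]].
  by rewrite (rides_inj_bike im jm kb lb h hl).
by have := none k kb; rewrite h.
Qed.

Lemma bike_at_le i j : (bike_at i j <= b)%N.
Proof. by case: (bike_atP i j) => [[k [_ _ ->]]|[_ ->]] //; lia. Qed.

(** Walking time [p] minus savings: on bike [k] these are the part of the segment from [psave k] to
    [at_pos k p] that lies in the piece of agent [i]. *)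
Definition elapsed (i : nat) (p : F) : F :=
  p - \sum_(k < b) (clamp (cut i) (cut i.+1) (at_pos k p) -
                    clamp (cut i) (cut i.+1) (psave k)).

Lemma elapsed0 i : elapsed i 0 = 0.
Proof.
by rewrite /elapsed big1 ?subr0 // => k _; rewrite at_pos0 subrr.
Qed.

Lemma sum_clamp i : (i < m)%N ->
  \sum_(k < b) (clamp (cut i) (cut i.+1) (psave k.+1) -
                clamp (cut i) (cut i.+1) (psave k)) = cut i.+1 - cut i.
Proof.
move=> im; rewrite -(big_mkord xpredT (fun k => clamp (cut i) (cut i.+1) (psave k.+1) -
                    clamp (cut i) (cut i.+1) (psave k))) telescope_sumr //.
by rewrite psave0 clamp_hi ?cut_leS -?cut_m ?cut_homo // clamp_lo ?cut_leS ?cut_ge0.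
Qed.

Lemma elapsed1 i : (i < m)%N -> elapsed i 1 = 1 - (cut i.+1 - cut i).
Proof.
move=> im; rewrite /elapsed; under eq_bigr do rewrite at_pos1.
by rewrite sum_clamp.
Qed.

Lemma le_sum_term (f : nat -> F) k : (k < b)%N ->
  (forall q, (q < b)%N -> 0 <= f q) -> f k <= \sum_(q < b) f q.
Proof.
move=> kb f0; rewrite (bigD1 (Ordinal kb)) //= lerDl.
by apply: sumr_ge0 => q _; exact: f0.
Qed.

(** By [no_cut_inside], a column of bike [k] lies either inside the piece of agent [i] or outside
    it, so each clamped difference is all or nothing, and at most one bike contributes. *)
Lemma elapsedS i j : (i < m)%N -> (j < m)%N ->
  elapsed i (brk j.+1) - elapsed i (brk j) =
  (1 - (if bike_at i j == 0%N then 0 else save (b - bike_at i j))) * collen j.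
Proof.
move=> im jm.
have le_j := brk_leS jm.
have step k : (k < b)%N ->
    clamp (cut i) (cut i.+1) (at_pos k (brk j.+1)) -
    clamp (cut i) (cut i.+1) (at_pos k (brk j)) =
    if rides i k j then save k * collen j else 0.
  move=> kb; have le_c := cut_leS i; have le_s := at_pos_homo kb le_j.
  case: ifP => [/andP[h1 h2]|/negbT].
    have h3 := no_cut_inside im kb jm h2.
    rewrite !clamp_id ?h1 ?(ltW h2) ?h3 ?(le_trans h1 le_s) //.
    by rewrite /at_pos /collen; ring.
  rewrite negb_and -leNgt -ltNge => /orP[h|h]; last first.
    by rewrite !clamp_hi ?subrr // (le_trans h).
  have h' := no_cut_inside (ltnW im) kb jm h.
  by rewrite !clamp_lo ?subrr // ltW.
have -> : elapsed i (brk j.+1) - elapsed i (brk j) =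
    collen j - \sum_(k < b) (if rides i k j then save k * collen j else 0).
  rewrite /elapsed -(eq_bigr _ (fun k _ => step (nat_of_ord k) (ltn_ord k))).
  by rewrite /collen !sumrB; ring.
case: (bike_atP i j) => [[k [kb hk ->]]|[none ->]]; last first.
  by rewrite eqxx big1 ?subr0 ?mul1r // => k _; rewrite (negbTE (none _ _)).
rewrite (bigD1 (Ordinal kb)) //= hk big1 => [|l ne]; last first.
  case: ifP => // hl; case/negP: ne; apply/eqP/val_inj => /=.
  exact: rides_inj_bike hl hk.
rewrite subn_eq0 leqNgt kb /= subKn; last exact: ltnW.
by ring.
Qed.

Variable u : b.-tuple F.
Hypothesis uw : forall k : 'I_b, tnth u k = w k.

(** With exactly [m] columns, integer cell 0 of the machine already holds the output size at the
    start. *)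
Definition wrap_schedule : schedule F m b :=
  @Schedule F m b m (\row_j collen j) (\matrix_(i, j) inord (bike_at i j)).

Lemma slab_wrap (i j : 'I_m) : slab wrap_schedule i j = bike_at i j :> nat.
Proof. by rewrite mxE inordK // ltnS bike_at_le. Qed.

Lemma slab_wrap_neq0 (i j : 'I_m) : slab wrap_schedule i j != ord0 ->
  exists k, [/\ (k < b)%N, rides i k j & slab wrap_schedule i j = (b - k)%N :> nat].
Proof.
move=> h; have {}h : slab wrap_schedule i j != 0%N :> nat by [].
move: h; rewrite slab_wrap; case: (bike_atP i j) => [[k [kb hk e]] _|[_ ->] //].
by exists k; rewrite e.
Qed.

Lemma slab_wrap_rides (i j : 'I_m) k : (k < b)%N -> rides i k j ->
  slab wrap_schedule i j = (b - k)%N :> nat.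
Proof. by move=> kb h; rewrite slab_wrap (bike_atE _ _ kb h). Qed.

Lemma inv_speed_wrap (i j : 'I_m) : inv_speed u (slab wrap_schedule i j) =
  1 - (if bike_at i j == 0%N then 0 else save (b - bike_at i j)).
Proof.
rewrite /inv_speed (tnth_nth 0) slab_wrap.
case: (bike_atP i j) => [[k [kb hk ->]]|[_ ->]]; last by rewrite subr0.
rewrite subn_eq0 leqNgt kb /= subKn; last exact: ltnW.
have kb' : (b - 1 - k < b)%N by lia.
rewrite (_ : (b - k)%N = (b - 1 - k).+1); last by lia.
by rewrite /save subKr /= -(uw (Ordinal kb')) (tnth_nth 0).
Qed.

Lemma wrap_step (i j : 'I_m) :
  inv_speed u (slab wrap_schedule i j) * slen wrap_schedule 0 j =
  elapsed i (brk j.+1) - elapsed i (brk j).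
Proof. by rewrite inv_speed_wrap mxE elapsedS. Qed.

Lemma time_at_wrap (i j : 'I_m) :
  @time_at F m b u wrap_schedule i j = elapsed i (brk j.+1).
Proof.
rewrite /time_at (eq_bigr _ (fun k _ => wrap_step i k)).
rewrite (eq_bigl (fun k : 'I_m => (k < j.+1)%N)) //.
rewrite -(big_ord_widen _ (fun l => elapsed i (brk l.+1) - elapsed i (brk l)) (ltn_ord j)).
rewrite -(big_mkord xpredT (fun l => elapsed i (brk l.+1) - elapsed i (brk l))).
by rewrite telescope_sumr // brk0 elapsed0 subr0.
Qed.

Lemma arrival_wrap (i : 'I_m) :
  @arrival F m b u wrap_schedule i = 1 - (cut i.+1 - cut i).
Proof.
rewrite /arrival (eq_bigr _ (fun k _ => wrap_step i k)).
rewrite -(big_mkord xpredT (fun l => elapsed i (brk l.+1) - elapsed i (brk l))).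
by rewrite telescope_sumr // brk0 elapsed0 subr0 brk_m elapsed1.
Qed.

Lemma is_schedule_wrap : is_schedule wrap_schedule.
Proof.
split=> [j|]; first by rewrite mxE subr_ge0 brk_leS.
under eq_bigr do rewrite mxE.
rewrite -(big_mkord xpredT (fun l => brk l.+1 - brk l)).
by rewrite telescope_sumr // brk0 brk_m subr0.
Qed.

(* [i'] drops bike [k] at the break point [p], which must be the cut between
   [i'] and [i]. The savings of [i] before [p] are at most the share minus what
   [i] still gains from [k]; those of [i'] are at least what it gained from [k]. *)
Lemma handover (i i' j' j k : nat) : (i < m)%N -> (i' < m)%N -> (j < m)%N ->
  j = j'.+1 -> (k < b)%N -> rides i' k j' -> rides i k j ->
  elapsed i' (brk j) <= elapsed i (brk j).
Proof.
move=> im im' jm ej kb ride' ride; have jm' : (j' < m)%N by lia.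
have le_jj : brk j' <= brk j by rewrite ej brk_leS.
have le_ii := rider_le kb (at_pos_homo kb le_jj) ride' ride.
have [<- //|ne] := eqVneq i' i; have lt_ii : (i' < i)%N by lia.
have /andP[h1 h2] := ride'; have /andP[h3 h4] := ride.
(* Both cuts are squeezed onto the handover point: [no_cut_inside] puts the end of the piece of [i']
   at or beyond it, while that end is at most the start of the piece of [i], which is at most the
   handover point. *)
have e' : cut i'.+1 = at_pos k (brk j).
  apply/eqP; rewrite eq_le (le_trans (cut_homo lt_ii) h3) /= ej.
  by apply: no_cut_inside h2.
have e : cut i = at_pos k (brk j).
  by apply/eqP; rewrite eq_le h3 -e' cut_homo.
have p_gt0 : 0 < brk j.
  apply: le_lt_trans (brk_ge0 j') _.
  by rewrite -(at_pos_lt _ _ kb) -e'.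
have p_lt1 := brk_lt1 jm; set p := brk j in e e' p_gt0 p_lt1 *.
have lt_lo : psave k < at_pos k p by rewrite -at_pos0 at_pos_lt.
have lt_hi : at_pos k p < psave k.+1 by rewrite -at_pos1 at_pos_lt.
have rb := nsolo_le.
(* A solo piece starts at an end of a bike, and so does the piece after it; the handover point is
   strictly inside bike [k]. *)
have r_i' : (nsolo <= i')%N.
  rewrite leqNgt; apply/negP => lt_ir; move: lt_lo lt_hi.
  rewrite -e' cut_solo // => lt_lo lt_hi.
  have ib := leq_trans lt_ir rb; have := psave_ltW (ltnW kb) ib lt_lo.
  by rewrite ltnNge -ltnS (psave_ltW ib kb lt_hi).
have r_k : (nsolo <= k)%N.
  rewrite -ltnS; apply: psave_ltW => //; apply: le_lt_trans lt_hi.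
  by rewrite -e -cut_solo // cut_homo // (leq_trans r_i') // ltnW.
have d_k : share <= save k by apply: share_le_save; rewrite r_k.
have d_ge0 := share_ge0.
have ci' : cut i'.+1 = cut i' + share by apply: cutS_shared.
have ci : cut i.+1 = cut i + share.
  by apply: cutS_shared; apply: leq_trans r_i' (ltnW lt_ii).
rewrite /elapsed lerD2l lerN2.
have le_s q : (q < b)%N -> at_pos q p <= psave q.+1.
  by move=> qb; rewrite -at_pos1 at_pos_homo // ltW.
have ge_s q : (q < b)%N -> psave q <= at_pos q p.
  by move=> qb; rewrite -{1}at_pos0 at_pos_homo // ltW.
have le_c := cut_leS i; have le_c' := cut_leS i'.
have lo : clamp (cut i') (cut i'.+1) (at_pos k p) -
          clamp (cut i') (cut i'.+1) (psave k) <=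
    \sum_(q < b) (clamp (cut i') (cut i'.+1) (at_pos q p) -
                  clamp (cut i') (cut i'.+1) (psave q)).
  apply: (le_sum_term (f := fun q => clamp (cut i') (cut i'.+1) (at_pos q p) -
    clamp (cut i') (cut i'.+1) (psave q))) => // q qb.
  by rewrite subr_ge0 clamp_homo ?ge_s.
(* Here the savings after the handover are bounded below by those on bike [k]; the complement in the
   total gives the savings before it. *)
have hi : clamp (cut i) (cut i.+1) (psave k.+1) -
          clamp (cut i) (cut i.+1) (at_pos k p) <=
    (cut i.+1 - cut i) - \sum_(q < b)
       (clamp (cut i) (cut i.+1) (at_pos q p) - clamp (cut i) (cut i.+1) (psave q)).
  rewrite -sum_clamp // -sumrB.
  rewrite [leRHS](eq_bigr (fun q : 'I_b => clamp (cut i) (cut i.+1) (psave q.+1) -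
    clamp (cut i) (cut i.+1) (at_pos q p))) => [|q _]; last by ring.
  apply: (le_sum_term (f := fun q => clamp (cut i) (cut i.+1) (psave q.+1) -
    clamp (cut i) (cut i.+1) (at_pos q p))) => // q qb.
  by rewrite subr_ge0 clamp_homo ?le_s.
have c' : clamp (cut i') (cut i'.+1) (at_pos k p) = at_pos k p.
  by rewrite (clamp_hi le_c') e'.
have c : clamp (cut i) (cut i.+1) (at_pos k p) = at_pos k p.
  by rewrite (clamp_lo le_c) e.
rewrite c' in lo; rewrite c in hi.
have e_save : psave k.+1 = psave k + save k := psaveS k.
have e_p : at_pos k p = psave k + p * save k by [].
have s_k : 0 <= p * share <= p * save k.
  by rewrite mulr_ge0 ?ler_wpM2l // ltW.
(* Write [a] for [save k]. The two lower bounds become min(share, p a) for [i'] before the handover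
   and min(share, (1 - p) a) for [i] after it. *)
have {}lo : at_pos k p - Num.max (cut i') (psave k) <=
    \sum_(q < b) (clamp (cut i') (cut i'.+1) (at_pos q p) -
                  clamp (cut i') (cut i'.+1) (psave q)).
  apply: le_trans lo; rewrite lerD2l lerN2.
  case: (leP (cut i') (psave k)) => h.
    by rewrite clamp_id // h e' ltW.
  by rewrite clamp_lo // ltW.
have {}hi : Num.min (cut i.+1) (psave k.+1) - at_pos k p <=
    (cut i.+1 - cut i) - \sum_(q < b)
       (clamp (cut i) (cut i.+1) (at_pos q p) - clamp (cut i) (cut i.+1) (psave q)).
  apply: le_trans hi; rewrite lerD2r.
  case: (leP (cut i.+1) (psave k.+1)) => h; first by rewrite clamp_hi.
  by rewrite clamp_id // e !ltW.
have /andP[s_k1 s_k2] := s_k.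
have s_k3 : 0 <= (1 - p) * (save k - share).
  by rewrite mulr_ge0 // subr_ge0 // ltW.
move: lo hi; rewrite mulrBr !mulrBl !mul1r in s_k3.
set s1 := \sum_(q < b) _; set s2 := \sum_(q < b) _.
(* It remains that share - min(share, (1 - p) a) <= min(share, p a); when neither minimum is
   [share], this is share <= a. *)
by case: (leP (cut i') (psave k)) => hl; case: (leP (cut i.+1) (psave k.+1)) => hr lo hi; lra.
Qed.

Lemma feasible_wrap : feasible u wrap_schedule.
Proof.
split.
- move=> i j' j ej /slab_wrap_neq0[k [kb hk e]].
  have [i' im hi'] := rider_exists kb (ltn_ord j').
  exists (Ordinal im); apply: val_inj => /=.
  by rewrite e (slab_wrap_rides (i := Ordinal im) kb hi').
- move=> i i' j /slab_wrap_neq0[k [kb hk e]]; apply: contra => /eqP e'.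
  have n0 : slab wrap_schedule i' j != ord0.
    by rewrite -(inj_eq val_inj) /= e' e subn_eq0 -ltnNge.
  have [l [lb hl el]] := slab_wrap_neq0 n0.
  have kl : k = l by move: el; rewrite e' e; lia.
  by apply/eqP/val_inj; apply: rider_inj kb _ hk; rewrite kl.
move=> i i' j' j ej e /slab_wrap_neq0[k [kb hk ek]].
have n0 : slab wrap_schedule i' j' != ord0.
  by rewrite -(inj_eq val_inj) /= -e ek subn_eq0 -ltnNge.
have [l [lb hl el]] := slab_wrap_neq0 n0.
have kl : k = l by move: el; rewrite -e ek; lia.
rewrite -kl in hl; rewrite !time_at_wrap.
rewrite (_ : elapsed i (brk j'.+1) = elapsed i (brk j)) -?ej //.
exact: (handover (ltn_ord i) (ltn_ord i') (ltn_ord j) ej kb hl hk).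
Qed.

Lemma wrap_solution : bike_sharing_solution u wrap_schedule.
Proof.
split; [exact: is_schedule_wrap | exact: feasible_wrap |].
move=> l l0; have l_gt0 : (0 < l)%N by rewrite lt0n.
have lb : (l <= b)%N by rewrite -ltnS.
have kb : (b - l < b)%N by lia.
have jm : (m.-1 < m)%N by rewrite prednK.
have [i im hi] := rider_exists kb jm.
exists (Ordinal im), (Ordinal jm); split; first by rewrite /= prednK.
apply: val_inj; rewrite /= (slab_wrap_rides (i := Ordinal im) (j := Ordinal jm) kb hi).
by rewrite subKn.
Qed.

(** If [nsolo] is 0, every piece equals the mean. Otherwise every piece has length at least
    [save 0]: solo ones by monotonicity, shared ones by [save_le_share]. *)
Lemma arrival_wrap_le (i : 'I_m) :
  @arrival F m b u wrap_schedule i <= 1 - psave b / m%:R \/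
  exists k : 'I_b, @arrival F m b u wrap_schedule i <= tnth u k.
Proof.
rewrite arrival_wrap; have rb := nsolo_le.
have [r0|r0] := posnP nsolo.
  left; rewrite cutS_shared ?r0 // [cut i + _]addrC addrK /share r0.
  by rewrite psave0 !subr0 subn0.
have kb : (b - 1 < b)%N by lia.
(* The slowest bike comes last in the nondecreasing list. *)
right; exists (Ordinal kb); rewrite uw /=.
have -> : w (b - 1) = 1 - save 0 by rewrite /save subn0 opprB addrC subrK.
rewrite lerD2l lerN2; case: (leqP nsolo i) => h.
  rewrite cutS_shared // [cut i + _]addrC addrK.
  exact: save_le_share.
by rewrite cutS_solo // [cut i + _]addrC addrK save_homo //=; lia.
Qed.
End Algorithm.

(** * Optimality *)

Section Transfer.
Variables (F R : realFieldType) (f : {rmorphism F -> R}).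
Hypothesis f_mono : {mono f : x y / x <= y}.
Variables (m b : nat) (u : b.-tuple F).

Definition map_schedule (S : schedule F m b) : schedule R m b :=
  @Schedule R m b (ssize S) (map_mx f (slen S)) (slab S).

Lemma inv_speed_map (l : 'I_b.+1) :
  inv_speed (map_tuple f u) l = f (inv_speed u l).
Proof.
rewrite -[in RHS](tnth_map f) /inv_speed; congr tnth; apply: val_inj => /=.
by rewrite rmorph1.
Qed.

Lemma time_at_map (S : schedule F m b) (i : 'I_m) (j : 'I_(ssize S)) :
  @time_at R m b (map_tuple f u) (map_schedule S) i j = f (@time_at F m b u S i j).
Proof.
rewrite rmorph_sum; apply: eq_bigr => k _.
by rewrite rmorphM -inv_speed_map mxE.
Qed.

Lemma arrival_map (S : schedule F m b) (i : 'I_m) :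
  @arrival R m b (map_tuple f u) (map_schedule S) i = f (@arrival F m b u S i).
Proof.
rewrite rmorph_sum; apply: eq_bigr => k _.
by rewrite rmorphM -inv_speed_map mxE.
Qed.

Lemma bike_sharing_solution_map (S : schedule F m b) :
  bike_sharing_solution u S ->
  bike_sharing_solution (map_tuple f u) (map_schedule S).
Proof.
move=> [[x0 x1] [prev inj hand] ends]; split=> //.
  split=> [j|]; first by rewrite mxE -(rmorph0 f) f_mono.
  by rewrite -(rmorph1 f) -x1 rmorph_sum; apply: eq_bigr => j _; rewrite mxE.
split=> // i i' j' j ej e n0; rewrite !time_at_map f_mono.
exact: hand ej e n0.
Qed.

Hypotheses (m_gt0 : (0 < m)%N) (b_le_m : (b <= m)%N) (u_ok : valid_speeds u).

Lemma nth_speed_bounds k : (k < b)%N -> 0 < nth 0 u k < 1.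
Proof. by move=> kb; have := u_ok.2 (Ordinal kb); rewrite (tnth_nth 0). Qed.

Lemma nth_speed_homo k l : (k <= l < b)%N -> nth 0 u k <= nth 0 u l.
Proof.
move=> /andP[kl lb]; have [srt _] := u_ok.
by apply: (sorted_leq_nth le_trans lexx) => //; rewrite inE size_tuple; lia.
Qed.

(** The lower bounds are applied to the competitor over [R]; the arrival times of the constructed
    schedule are estimated in [F] and carried over by [f]. *)
Lemma wrap_optimal :
  arrival_time_optimal (map_tuple f u) (map_schedule (wrap_schedule m b (nth 0 u))).
Proof.
have uw (k : 'I_b) : tnth u k = nth 0 u k by rewrite (tnth_nth 0).
have sol := wrap_solution m_gt0 b_le_m nth_speed_bounds nth_speed_homo uw.
split=> [|S' sol']; first exact: bike_sharing_solution_map.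
have tau_ge k : f (tnth u k) <= tau (map_tuple f u) S'.
  by rewrite -tnth_map; exact: tau_ge_bike.
have mean : m%:R - f (psave b (nth 0 u) b) <= m%:R * tau (map_tuple f u) S'.
  have [sch feas _] := sol'.
  have -> : f (psave b (nth 0 u) b) = \sum_(k < b) (1 - tnth (map_tuple f u) k).
    rewrite rmorph_sum (reindex_inj rev_ord_inj) /=; apply: eq_bigr => k _.
    rewrite /save rmorphB rmorph1 tnth_map uw /=; congr (1 - f (nth _ _ _)).
    by have := ltn_ord k; lia.
  apply: tau_ge_mean => // k; rewrite tnth_map -(rmorph1 f) f_mono.
  by have /andP[_ /ltW] := u_ok.2 k.
have m0 : 0 < m%:R :> R by rewrite ltr0n.
apply: tau_le => [|i]; first exact: bigmax_ge_id.
rewrite arrival_map.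
have [h|[k h]] := arrival_wrap_le m_gt0 b_le_m nth_speed_bounds nth_speed_homo uw i.
  rewrite -(ler_pM2l m0); apply: le_trans mean.
  move: h; rewrite -f_mono => h.
  apply: (@le_trans _ _ (m%:R * f (1 - psave b (nth 0 u) b / m%:R))).
    by rewrite ler_pM2l.
  rewrite rmorphB rmorph1 fmorph_div rmorph_nat mulrBr mulr1 mulrC divfK //.
  by rewrite gt_eqF.
by apply: le_trans (tau_ge k); rewrite f_mono.
Qed.
End Transfer.

(** * Cost-bounding Hoare logic *)

Lemma ltn_nat_bits n : (n < 2 ^ nat_bits n)%N.
Proof. exact: trunc_log_ltn. Qed.

Lemma nat_bits_le n k : (0 < k)%N -> (n < 2 ^ k)%N -> (nat_bits n <= k)%N.
Proof.
case: k => // k _ h; rewrite /nat_bits ltnS.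
have [->|n0] := posnP n; first by rewrite trunc_log0.
rewrite -ltnS -(ltn_exp2l _ _ (ltnSn 1)).
exact: leq_ltn_trans (trunc_logP (ltnSn 1) n0) h.
Qed.

Lemma nat_bits_homo n k : (n <= k)%N -> (nat_bits n <= nat_bits k)%N.
Proof. by move=> h; rewrite ltnS leq_trunc_log. Qed.

Lemma nat_bits_leS n : (nat_bits n <= n.+1)%N.
Proof. by apply: nat_bits_le => //; apply: (ltn_trans (ltnSn n)); apply: ltn_expl. Qed.

Lemma nat_bitsD k l : (nat_bits (k + l) <= nat_bits k + nat_bits l)%N.
Proof.
apply: nat_bits_le; rewrite ?addn_gt0 //.
have := ltn_nat_bits k; have := ltn_nat_bits l; rewrite expnD.
have : (2 <= 2 ^ nat_bits k)%N by rewrite -[X in (X <= _)%N](expn1 2) leq_exp2l.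
have : (2 <= 2 ^ nat_bits l)%N by rewrite -[X in (X <= _)%N](expn1 2) leq_exp2l.
by nia.
Qed.

Lemma nat_bitsM k l : (nat_bits (k * l) <= nat_bits k + nat_bits l)%N.
Proof.
apply: nat_bits_le; rewrite ?addn_gt0 // expnD.
by apply: ltn_mul; apply: ltn_nat_bits.
Qed.

Lemma horner_nat_homo (p : {poly nat}) x y : (x <= y)%N -> (p.[x] <= p.[y])%N.
Proof.
move=> xy; elim/poly_ind: p => [|p c IH]; first by rewrite !horner0.
by rewrite !hornerMXaddC; apply: leq_add => //; apply: leq_mul.
Qed.

(* [bnd L x] says that [x] has some, not necessarily reduced, representation of
   size [L]: unlike [sz], it grows additively under the field operations. *)
Record size_bound (F : realFieldType) (sz : F -> nat) (bnd : nat -> F -> Prop) :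
    Prop := SizeBound {
  bnd_homo : forall L L' x, (L <= L')%N -> bnd L x -> bnd L' x;
  bnd_nat : forall n, bnd (nat_bits n) n%:R;
  bndD : forall L L' x y, bnd L x -> bnd L' y -> bnd (L + L' + 1)%N (x + y);
  bndB : forall L L' x y, bnd L x -> bnd L' y -> bnd (L + L' + 1)%N (x - y);
  bndM : forall L L' x y, bnd L x -> bnd L' y -> bnd (L + L' + 1)%N (x * y);
  bndV : forall L L' x y, bnd L x -> bnd L' y -> bnd (L + L' + 1)%N (x / y);
  sz_le_bnd : forall L x, bnd L x -> (sz x <= 2 * L + 2)%N;
  bnd_sz : forall x, bnd (sz x) x }.

(** Bit length of a value in units of [W], the bound on every cell: sums and products at most add
    bit lengths, and a cell read counts 1 whatever its address. *)
Fixpoint iweight (e : iexp) : nat :=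
  match e with
  | ICst n => nat_bits n
  | IGet _ => 1
  | IAdd e1 e2 | ISub e1 e2 | IMul e1 e2 => iweight e1 + iweight e2
  end.

Fixpoint icost_weight (e : iexp) : nat :=
  (iweight e +
   match e with
   | ICst _ => 0
   | IGet a => icost_weight a
   | IAdd e1 e2 | ISub e1 e2 | IMul e1 e2 => icost_weight e1 + icost_weight e2
   end)%N.

Fixpoint fweight (e : fexp) : nat :=
  match e with
  | FNat a => iweight a
  | FGet _ => 1
  | FAdd e1 e2 | FSub e1 e2 | FMul e1 e2 | FDiv e1 e2 =>
      (fweight e1 + fweight e2 + 1)%N
  end.

Fixpoint fcost_weight (e : fexp) : nat :=
  (2 * fweight e + 2 +
   match e with
   | FNat a | FGet a => icost_weight a
   | FAdd e1 e2 | FSub e1 e2 | FMul e1 e2 | FDiv e1 e2 =>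
       fcost_weight e1 + fcost_weight e2
   end)%N.

Fixpoint bcost_weight (e : bexp) : nat :=
  match e with
  | BIle e1 e2 => (icost_weight e1 + icost_weight e2).+1
  | BFle e1 e2 => (fcost_weight e1 + fcost_weight e2).+1
  | BNot e1 => (bcost_weight e1).+1
  | BAnd e1 e2 => (bcost_weight e1 + bcost_weight e2).+1
  end.

(* The indeterminate stands for a bound on the number of iterations of every
   execution of every loop. *)
Fixpoint cmd_weight (c : cmd) : {poly nat} :=
  match c with
  | Skip => 1%:P
  | ISet a e => ((icost_weight a + icost_weight e).+1)%:P
  | FSet a e => ((icost_weight a + fcost_weight e).+1)%:P
  | Seq c1 c2 => cmd_weight c1 + cmd_weight c2
  | If e c1 c2 => (bcost_weight e)%:P + (cmd_weight c1 + cmd_weight c2)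
  | While e c => ('X + 1%:P) * (bcost_weight e)%:P + 'X * cmd_weight c
  end.

Definition For (v n : iexp) (c : cmd) : cmd :=
  Seq (ISet v (ICst 0))
      (While (BNot (BIle n (IGet v)))
             (Seq c (ISet v (IAdd (IGet v) (ICst 1))))).

Section Hoare.
Variables (F : realFieldType) (sz : F -> nat) (bnd : nat -> F -> Prop).
Hypothesis sb : size_bound sz bnd.
Variables (W m : nat).
Hypothesis W_gt0 : (0 < W)%N.

Definition bounded (s : state F) : Prop :=
  (forall a, (nat_bits (imem s a) <= W)%N) /\ (forall a, bnd W (fmem s a)).

Lemma nat_bits_ieval s e : bounded s -> (nat_bits (ieval s e) <= iweight e * W)%N.
Proof.
move=> [hi _]; elim: e => [n|a _|a ha c hc|a ha c hc|a ha c hc] /=.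
- by rewrite leq_pmulr.
- by rewrite mul1n.
- by rewrite mulnDl (leq_trans (nat_bitsD _ _)) ?leq_add.
- rewrite mulnDl (leq_trans _ (leq_addr _ _)) // (leq_trans _ ha) //.
  by rewrite nat_bits_homo ?leq_subr.
- by rewrite mulnDl (leq_trans (nat_bitsM _ _)) ?leq_add.
Qed.

Lemma icost_le s e : bounded s -> (icost s e <= icost_weight e * W)%N.
Proof.
move=> hs; elim: e => [n|a ha|a ha c hc|a ha c hc|a ha c hc].
- by move: (nat_bits_ieval (ICst n) hs); rewrite /= !addn0.
- by rewrite mulnDl leq_add // (nat_bits_ieval (IGet a)).
- by rewrite mulnDl leq_add ?(nat_bits_ieval (IAdd a c)) // mulnDl leq_add.
- by rewrite mulnDl leq_add ?(nat_bits_ieval (ISub a c)) // mulnDl leq_add.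
- by rewrite mulnDl leq_add ?(nat_bits_ieval (IMul a c)) // mulnDl leq_add.
Qed.

Lemma bnd_feval s e : bounded s -> bnd (fweight e * W)%N (feval s e).
Proof.
move=> hs; have le_op k l : (k * W + l * W + 1 <= (k + l + 1) * W)%N by nia.
elim: e => [a|a|a ha c hc|a ha c hc|a ha c hc|a ha c hc] /=.
- exact: bnd_homo sb _ _ _ (nat_bits_ieval a hs) (bnd_nat sb _).
- by rewrite mul1n; exact: hs.2.
- exact: bnd_homo sb _ _ _ (le_op _ _) (bndD sb ha hc).
- exact: bnd_homo sb _ _ _ (le_op _ _) (bndB sb ha hc).
- exact: bnd_homo sb _ _ _ (le_op _ _) (bndM sb ha hc).
- exact: bnd_homo sb _ _ _ (le_op _ _) (bndV sb ha hc).
Qed.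

Lemma fcost_le s e : bounded s -> (fcost sz s e <= fcost_weight e * W)%N.
Proof.
move=> hs; have sz_le e' : (sz (feval s e') <= (2 * fweight e' + 2) * W)%N.
  apply: leq_trans (sz_le_bnd sb (bnd_feval e' hs)) _; nia.
elim: e => [a|a|a ha c hc|a ha c hc|a ha c hc|a ha c hc].
- by rewrite mulnDl leq_add ?(sz_le (FNat a)) ?icost_le.
- by rewrite mulnDl leq_add ?(sz_le (FGet a)) ?icost_le.
- by rewrite mulnDl leq_add ?(sz_le (FAdd a c)) // mulnDl leq_add.
- by rewrite mulnDl leq_add ?(sz_le (FSub a c)) // mulnDl leq_add.
- by rewrite mulnDl leq_add ?(sz_le (FMul a c)) // mulnDl leq_add.
- by rewrite mulnDl leq_add ?(sz_le (FDiv a c)) // mulnDl leq_add.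
Qed.

Lemma bcost_le s e : bounded s -> (bcost sz s e <= bcost_weight e * W)%N.
Proof.
move=> hs; elim: e => [a c|a c|e he|a ha c hc] /=; rewrite mulSn -addn1 addnC.
- by apply: leq_add => //; rewrite mulnDl leq_add ?icost_le.
- by apply: leq_add => //; rewrite mulnDl leq_add ?fcost_le.
- by apply: leq_add.
- by apply: leq_add => //; rewrite mulnDl leq_add.
Qed.

(** Total correctness with cost. As [bounded] is assumed and guaranteed for the same [W], each
    stored value must be bounded from its meaning, and growth cannot compound along a loop. *)
Definition hoare (P : state F -> Prop) (c : cmd) (Q : state F -> Prop) : Prop :=
  forall s, bounded s -> P s -> exists t s',
    [/\ exec sz c s t s', (t <= (cmd_weight c).[m] * W)%N, bounded s' & Q s'].

Lemma hoare_conseq (P P' Q Q' : state F -> Prop) c :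
  (forall s, P s -> P' s) -> (forall s, Q' s -> Q s) ->
  hoare P' c Q' -> hoare P c Q.
Proof.
move=> hP hQ h s hs /hP/(h s hs)[t [s' [e ht hs' /hQ hq]]].
by exists t, s'.
Qed.

Lemma hoare_seq P Q R c1 c2 : hoare P c1 Q -> hoare Q c2 R ->
  hoare P (Seq c1 c2) R.
Proof.
move=> h1 h2 s hs /(h1 s hs)[t1 [s1 [e1 ht1 hs1 /(h2 s1 hs1)]]].
move=> [t2 [s2 [e2 ht2 hs2 hR]]]; exists (t1 + t2)%N, s2; split=> //.
  exact: ExecSeq e1 e2.
by rewrite hornerD mulnDl leq_add.
Qed.

Lemma hoare_skip P : hoare P Skip P.
Proof.
move=> s hs hP; exists 1%N, s; split=> //; first exact: ExecSkip.
by rewrite hornerC mul1n.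
Qed.

Lemma hoare_iset P a e Q :
  (forall s, P s -> (nat_bits (ieval s e) <= W)%N /\
     Q (State (upd (imem s) (ieval s a) (ieval s e)) (fmem s))) ->
  hoare P (ISet a e) Q.
Proof.
move=> h s hs /h[hW hQ].
exists (icost s a + icost s e).+1,
  (State (upd (imem s) (ieval s a) (ieval s e)) (fmem s)); split=> //.
- exact: ExecISet.
- rewrite hornerC mulSn -addn1 addnC leq_add // mulnDl.
  by rewrite leq_add ?icost_le.
- split=> [k|]; last exact: hs.2.
  by rewrite /= /upd; case: ifP => // _; exact: hs.1.
Qed.

Lemma hoare_fset P a e Q :
  (forall s, P s -> bnd W (feval s e) /\
     Q (State (imem s) (upd (fmem s) (ieval s a) (feval s e)))) ->
  hoare P (FSet a e) Q.
Proof.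
move=> h s hs /h[hW hQ].
exists (icost s a + fcost sz s e).+1,
  (State (imem s) (upd (fmem s) (ieval s a) (feval s e))); split=> //.
- exact: ExecFSet.
- rewrite hornerC mulSn -addn1 addnC leq_add // mulnDl.
  by rewrite leq_add ?icost_le ?fcost_le.
- split=> [|k]; first exact: hs.1.
  by rewrite /= /upd; case: ifP => // _; exact: hs.2.
Qed.

(** The preconditions in use determine the relevant memory and hence the test, so only the branch
    taken has to be verified. *)
Lemma hoare_if P e (v : bool) c1 c2 Q :
  (forall s, P s -> beval s e = v) -> hoare P (if v then c1 else c2) Q ->
  hoare P (If e c1 c2) Q.
Proof.
move=> hv h s hs hP; have [t [s' [ex ht hs' hQ]]] := h s hs hP.
exists (bcost sz s e + t)%N, s'; split=> //.
  by apply: ExecIf; rewrite hv.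
rewrite /= hornerD hornerC mulnDl leq_add ?bcost_le // hornerD mulnDl.
by apply: (leq_trans ht); case: (v); rewrite ?leq_addr ?leq_addl.
Qed.

Lemma hoare_while (J : nat -> state F -> Prop) e c n : (n <= m)%N ->
  (forall k s, (k <= n)%N -> J k s -> beval s e = (k < n)%N) ->
  (forall k, (k < n)%N -> hoare (J k) c (J k.+1)) ->
  hoare (J 0%N) (While e c) (J n).
Proof.
move=> nm he hc s hs hJ.
(* Induction on the number [d] of rounds left; the test runs once more than the body. *)
suff : forall d k s, (d + k = n)%N -> bounded s -> J k s -> exists t s',
    [/\ exec sz (While e c) s t s',
     (t <= (d.+1 * bcost_weight e + d * (cmd_weight c).[m]) * W)%N,
     bounded s' & J n s'].
  move=> /(_ n 0%N s (addn0 n) hs hJ)[t [s' [ex ht hs' hJ']]].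
  exists t, s'; split=> //; apply: (leq_trans ht).
  rewrite /= hornerD !hornerM hornerD hornerX !hornerC leq_mul2r; apply/orP; right.
  by apply: leq_add; apply: leq_mul => //; rewrite -[leqRHS]/(m + 1)%N addn1 ltnS.
elim=> [|d IH] k {}s ek {}hs {}hJ.
  move: ek hJ; rewrite add0n => -> hJ; exists (bcost sz s e), s; split=> //.
    by apply: ExecWhileEnd; rewrite (he n) // ltnn.
  by rewrite mul1n mul0n addn0 bcost_le.
have lt_kn : (k < n)%N by lia.
have [t1 [s1 [ex1 ht1 hs1 hJ1]]] := hc k lt_kn s hs hJ.
have [|t2 [s2 [ex2 ht2 hs2 hJ2]]] := IH k.+1 s1 _ hs1 hJ1; first by lia.
exists (bcost sz s e + t1 + t2)%N, s2; split=> //.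
  by apply: ExecWhileStep ex1 ex2; rewrite (he k) // ltnW.
have := bcost_le e hs; move: ht1 ht2; rewrite mulSn; lia.
Qed.
End Hoare.

(** * Program and memory layout *)

Definition numAgents : iexp := IGet (ICst 0).
(* Cells 1, ..., m * m hold the matrix, so that the address of every scratch
   variable depends on m. *)
Definition var (q : nat) : iexp := IAdd (IMul numAgents numAgents) (ICst q).
Definition numBikes : iexp := IGet (var 1).
Definition numSolo : iexp := IGet (var 2).
Definition ctr (d : nat) : iexp := IGet (var (3 + d)).
Definition succ_exp (e : iexp) : iexp := IAdd e (ICst 1).
(** Each array has [m + 1] cells, since break points are indexed from 0 to [m]. Array 0 begins at
    address 0, where the speeds arrive and the lengths must be left. *)
Definition cell (q : nat) (e : iexp) : iexp :=
  IAdd (IMul (ICst q) (succ_exp numAgents)) e.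
Definition arr (q : nat) (e : iexp) : fexp := FGet (cell q e).
Definition for_ (d : nat) (n : iexp) (c : cmd) : cmd := For (var (3 + d)) n c.

Definition cut_exp (e : iexp) : fexp :=
  FAdd (arr 1 (ISub e (ISub e numSolo)))
       (FDiv (FMul (FNat (ISub e numSolo))
                   (FSub (arr 1 numBikes) (arr 1 numSolo)))
             (FNat (ISub numAgents numSolo))).

Definition pt_exp (k j : iexp) : fexp :=
  FAdd (arr 1 k) (FMul (arr 3 j) (FSub (arr 1 (succ_exp k)) (arr 1 k))).

(** Cell 1 is the first entry of the output matrix. It is cleared because [compute_bikes] writes
    only the entries of riders. *)
Definition save_b : cmd :=
  Seq (ISet (var 1) (IGet (ICst 1))) (ISet (ICst 1) (ICst 0)).

Definition compute_psave : cmd :=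
  for_ 0 numBikes
    (FSet (cell 1 (succ_exp (ctr 0)))
       (FAdd (arr 1 (ctr 0))
          (FSub (FNat (ICst 1))
                (arr 0 (ISub (ISub numBikes (ICst 1)) (ctr 0)))))).

Definition compute_nsolo : cmd :=
  for_ 0 numBikes
    (If (BNot (BFle (FSub (arr 1 numBikes) (arr 1 (ctr 0)))
                    (FMul (FSub (arr 1 (succ_exp (ctr 0))) (arr 1 (ctr 0)))
                          (FNat (ISub numAgents (ctr 0))))))
        (ISet (var 2) (succ_exp (ctr 0))) Skip).

Definition compute_cutpos : cmd :=
  for_ 0 numAgents (for_ 1 numBikes
    (If (BAnd (BFle (arr 1 (ctr 1)) (cut_exp (ctr 0)))
              (BNot (BFle (arr 1 (succ_exp (ctr 1))) (cut_exp (ctr 0)))))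
        (FSet (cell 2 (ctr 0))
           (FDiv (FSub (cut_exp (ctr 0)) (arr 1 (ctr 1)))
                 (FSub (arr 1 (succ_exp (ctr 1))) (arr 1 (ctr 1))))) Skip)).

(** Array 3 is filled from the right; the cell [cur], initially 0, serves as the running maximum of
    [max_below]. *)
Definition compute_brk : cmd :=
  let cur := ISub numAgents (succ_exp (ctr 0)) in
  Seq (FSet (cell 3 numAgents) (FNat (ICst 1)))
  (for_ 0 numAgents (for_ 1 numAgents
    (If (BAnd (BNot (BFle (arr 3 (ISub numAgents (ctr 0))) (arr 2 (ctr 1))))
              (BNot (BFle (arr 2 (ctr 1)) (arr 3 cur))))
        (FSet (cell 3 cur) (arr 2 (ctr 1))) Skip))).

Definition compute_bikes : cmd :=
  for_ 0 numAgents (for_ 1 numAgents (for_ 2 numBikes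
    (If (BAnd (BFle (cut_exp (ctr 0)) (pt_exp (ctr 2) (ctr 1)))
              (BNot (BFle (cut_exp (succ_exp (ctr 0))) (pt_exp (ctr 2) (ctr 1)))))
        (ISet (IAdd (IAdd (ICst 1) (IMul (ctr 0) numAgents)) (ctr 1))
              (ISub numBikes (ctr 2))) Skip))).

(** Overwrites the inverse speeds, which only [compute_psave] reads. *)
Definition compute_lengths : cmd :=
  for_ 0 numAgents
    (FSet (cell 0 (ctr 0)) (FSub (arr 3 (succ_exp (ctr 0))) (arr 3 (ctr 0)))).

Definition program : cmd :=
  Seq save_b (Seq compute_psave (Seq compute_nsolo (Seq compute_cutpos
  (Seq compute_brk (Seq compute_bikes compute_lengths))))).

Record config (F : Type) : Type := Config {
  csolo : nat;
  carr : nat -> nat -> F;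
  cmat : nat -> nat -> nat }.

Lemma mat_addr m i j : (i < m)%N -> (j < m)%N -> (0 < 1 + i * m + j <= m * m)%N.
Proof.
move=> im jm; have : (i.+1 * m <= m * m)%N by rewrite leq_mul2r im orbT.
by rewrite mulSn; lia.
Qed.

Lemma mat_addr_inj m i j i' j' : (j < m)%N -> (j' < m)%N ->
  (1 + i * m + j == 1 + i' * m + j')%N = (i == i') && (j == j').
Proof.
move=> jm jm'; apply/eqP/andP => [e|[/eqP -> /eqP -> //]].
have m0 : (0 < m)%N := leq_ltn_trans (leq0n j) jm.
have e' : (i * m + j = i' * m + j')%N by lia.
have := congr1 (fun x => x %/ m)%N e'; have := congr1 (fun x => x %% m)%N e'.
by rewrite !modnMDl !divnMDl // !modn_small // !divn_small // !addn0 => -> ->.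
Qed.

Lemma arr_addr_inj m q i q' i' : (i <= m)%N -> (i' <= m)%N ->
  (q * (m + 1) + i == q' * (m + 1) + i')%N = (q == q') && (i == i').
Proof.
move=> im im'; apply/eqP/andP => [e|[/eqP -> /eqP -> //]].
have := congr1 (fun x => x %/ (m + 1))%N e; have := congr1 (fun x => x %% (m + 1))%N e.
have m1 : (0 < m + 1)%N by rewrite addn1.
by rewrite !modnMDl !divnMDl // !modn_small ?addn1 ?ltnS // !divn_small // !addn0 => -> ->.
Qed.

Section Layout.
Variables (F : realFieldType) (sz : F -> nat) (bnd : nat -> F -> Prop).
Hypothesis sb : size_bound sz bnd.
Variables (W m b : nat).
Hypotheses (m_lt_W : (m < W)%N) (m_gt0 : (0 < m)%N) (b_le_m : (b <= m)%N).

(* [c] lists the values of the counters of the enclosing loops. *)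
Definition models (g : config F) (c : seq nat) (s : state F) : Prop :=
  [/\ imem s 0 = m,
      imem s (m * m + 1) = b /\ imem s (m * m + 2) = csolo g,
      forall l, (l < size c)%N -> imem s (m * m + (3 + l)) = nth 0%N c l,
      forall q i, (i <= m)%N -> fmem s (q * (m + 1) + i) = carr g q i &
      forall i j, (i < m)%N -> (j < m)%N -> imem s (1 + i * m + j) = cmat g i j].

(** Agreement on the range seen by [models] lets differently written configurations be exchanged
    without function extensionality. *)
Definition same_config (g g' : config F) : Prop :=
  [/\ csolo g' = csolo g,
      forall q i, (i <= m)%N -> carr g' q i = carr g q i &
      forall i j, (i < m)%N -> (j < m)%N -> cmat g' i j = cmat g i j].

Lemma models_same g g' c s : same_config g g' -> models g c s -> models g' c s.
Proof.
move=> [e1 e2 e3] [h1 h2 h3 h4 h5]; split=> //; first by rewrite e1.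
  by move=> q i im; rewrite e2 ?h4.
by move=> i j im jm; rewrite e3 ?h5.
Qed.

Lemma models_rcons g c k s : models g (rcons c k) s -> models g c s.
Proof.
move=> [h1 h2 h3 h4 h5]; split=> // l lc.
by rewrite h3 ?size_rcons ?leqW // nth_rcons lc.
Qed.

Local Notation triple := (hoare sz bnd W m).

Lemma bits_le_W v : (v <= m)%N -> (nat_bits v <= W)%N.
Proof. by move=> vm; apply: leq_trans (nat_bits_leS v) _; apply: leq_ltn_trans vm m_lt_W. Qed.

Lemma triple_same g g1 g2 g' c p : same_config g g1 -> same_config g2 g' ->
  triple (models g1 c) p (models g2 c) -> triple (models g c) p (models g' c).
Proof. by move=> h1 h2; apply: hoare_conseq => s; exact: models_same. Qed.

Lemma triple_skip g g' c : same_config g g' ->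
  triple (models g c) Skip (models g' c).
Proof.
move=> h; have W0 : (0 < W)%N by apply: leq_ltn_trans m_lt_W.
apply: (hoare_conseq (P' := models g' c) (Q' := models g' c)) => // [s|].
  exact: models_same.
exact: hoare_skip.
Qed.

(** Serves both the initialisation of a counter, with [c' = c], and its increment, with
    [c' = rcons c k]. *)
Lemma models_set_ctr g c c' v s : (forall l, (l < size c)%N -> nth 0%N c' l = nth 0%N c l) ->
  (size c <= size c')%N -> models g c' s ->
  models g (rcons c v) (State (upd (imem s) (m * m + (3 + size c)) v) (fmem s)).
Proof.
move=> hc hs [h1 [h2 h2'] h3 h4 h5]; split=> //=; rewrite /upd.
- by case: eqP => // e; lia.
- by split; case: eqP => // e; lia.
- move=> l; rewrite size_rcons ltnS nth_rcons => lc.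
  rewrite eqn_add2l eqn_add2l; case: eqP => [->|ne]; first by rewrite ltnn.
  have lc' : (l < size c)%N by lia.
  by rewrite lc' h3 ?hc // (leq_trans lc').
- move=> i j im jm; have := mat_addr im jm; case: eqP => [-> h|_ _]; last exact: h5.
  by lia.
Qed.

Lemma triple_for (K : nat -> config F) c N n body : (n <= m)%N ->
  (forall k c' s, models (K k) c' s -> ieval s N = n) ->
  (forall k, (k < n)%N ->
     triple (models (K k) (rcons c k)) body (models (K k.+1) (rcons c k))) ->
  triple (models (K 0%N) c) (for_ (size c) N body) (models (K n) c).
Proof.
move=> nm hN hb.
have W0 : (0 < W)%N by apply: leq_ltn_trans m_lt_W.
apply: (hoare_seq (Q := models (K 0%N) (rcons c 0))).
  apply: (hoare_iset sz m W0) => s hs; split; first exact: bits_le_W.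
  by have [e _ _ _ _] := hs; rewrite /= e; apply: models_set_ctr hs.
apply: (hoare_conseq (P' := models (K 0%N) (rcons c 0))
          (Q' := models (K n) (rcons c n))) => // [s|]; first exact: models_rcons.
apply: (hoare_while sb W0 (J := fun k => models (K k) (rcons c k)) nm) => [k s kn hs|k kn].
  rewrite [LHS]/=.
  have [e _ hc _ _] := hs.
  by rewrite (hN _ _ _ hs) -ltnNge e hc ?size_rcons // nth_rcons ltnn eqxx.
apply: hoare_seq (hb k kn) _.
apply: (hoare_iset sz m W0) => s hs; have [e _ hc _ _] := hs.
rewrite /= e hc ?size_rcons // nth_rcons ltnn eqxx addn1; split.
  by apply: bits_le_W; apply: leq_trans nm.
apply: models_set_ctr hs; last by rewrite size_rcons.
by move=> l lc; rewrite nth_rcons lc.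
Qed.

Lemma triple_fset g g' c a e q i v : (i <= m)%N ->
  (forall s, models g c s -> ieval s a = (q * (m + 1) + i)%N) ->
  (forall s, models g c s -> feval s e = v) -> bnd W v ->
  csolo g' = csolo g ->
  (forall q' i', (i' <= m)%N ->
     carr g' q' i' = if (q' == q) && (i' == i) then v else carr g q' i') ->
  (forall i' j', (i' < m)%N -> (j' < m)%N -> cmat g' i' j' = cmat g i' j') ->
  triple (models g c) (FSet a e) (models g' c).
Proof.
move=> im ha he hv e1 e2 e3.
have W0 : (0 < W)%N by apply: leq_ltn_trans m_lt_W.
apply: (hoare_fset sb m W0) => s hs; rewrite (ha s hs) (he s hs); split=> //.
have [h1 h2 h3 h4 h5] := hs; split=> //=; first by rewrite e1.
  by move=> q' i' im'; rewrite /upd arr_addr_inj // e2 // h4.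
by move=> i' j' im' jm'; rewrite e3 // h5.
Qed.

Lemma triple_mset g g' c a e i j v : (i < m)%N -> (j < m)%N ->
  (forall s, models g c s -> ieval s a = (1 + i * m + j)%N) ->
  (forall s, models g c s -> ieval s e = v) -> (v <= m)%N ->
  csolo g' = csolo g ->
  (forall q' i', (i' <= m)%N -> carr g' q' i' = carr g q' i') ->
  (forall i' j', (i' < m)%N -> (j' < m)%N ->
     cmat g' i' j' = if (i' == i) && (j' == j) then v else cmat g i' j') ->
  triple (models g c) (ISet a e) (models g' c).
Proof.
move=> im jm ha he hv e1 e2 e3; have aij := mat_addr im jm.
have W0 : (0 < W)%N by apply: leq_ltn_trans m_lt_W.
apply: (hoare_iset sz m W0) => s hs; rewrite (ha s hs) (he s hs); split.
  exact: bits_le_W.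
have [h1 [h2 h2'] h3 h4 h5] := hs; split=> //=; rewrite /upd.
- by rewrite e1; split; case: eqP => // e0; lia.
- by move=> l lc; case: eqP => [e0|_]; [lia | exact: h3].
- by move=> q' i' im'; rewrite e2 // h4.
- by move=> i' j' im' jm'; rewrite mat_addr_inj // e3 // h5.
Qed.

Lemma triple_rset g g' c e v :
  (forall s, models g c s -> ieval s e = v) -> (v <= m)%N -> csolo g' = v ->
  (forall q' i', (i' <= m)%N -> carr g' q' i' = carr g q' i') ->
  (forall i' j', (i' < m)%N -> (j' < m)%N -> cmat g' i' j' = cmat g i' j') ->
  triple (models g c) (ISet (var 2) e) (models g' c).
Proof.
move=> he hv e1 e2 e3.
have W0 : (0 < W)%N by apply: leq_ltn_trans m_lt_W.
apply: (hoare_iset sz m W0) => s hs; rewrite (he s hs); split; first exact: bits_le_W.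
have [h1 [h2 h2'] h3 h4 h5] := hs; rewrite /= h1; split=> //=; rewrite /upd.
- by case: eqP => // e0; lia.
- by rewrite e1 eqxx; split=> //; case: eqP => // e0; lia.
- by move=> l lc; case: eqP => [e0|_]; [lia | exact: h3].
- by move=> q' i' im'; rewrite e2 // h4.
- move=> i' j' im' jm'; have := mat_addr im' jm'.
  by rewrite e3 //; case: eqP => [e0|_ _]; [lia | exact: h5].
Qed.

Section Eval.
Variables (g : config F) (c : seq nat) (s : state F).
Hypothesis hs : models g c s.

Lemma eval_agents : ieval s numAgents = m.
Proof. by case: hs. Qed.

Lemma eval_bikes : ieval s numBikes = b.
Proof. by case: hs => h [h' _] _ _ _; rewrite /= h. Qed.

Lemma eval_solo : ieval s numSolo = csolo g.
Proof. by case: hs => h [_ h'] _ _ _; rewrite /= h. Qed.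

Lemma eval_ctr l : (l < size c)%N -> ieval s (ctr l) = nth 0%N c l.
Proof. by move=> lc; case: hs => h _ h' _ _; rewrite /= h -h'. Qed.

Lemma eval_cell q e : ieval s (cell q e) = (q * (m + 1) + ieval s e)%N.
Proof. by case: hs => h _ _ _ _; rewrite /= h. Qed.

Lemma eval_arr q e : (ieval s e <= m)%N -> feval s (arr q e) = carr g q (ieval s e).
Proof. by case: hs => h _ _ h' _ em; rewrite -h' //= h. Qed.
End Eval.
End Layout.

(** * Correctness of the program *)

Definition layout (T : Type) (d : T) (x y z t : nat -> T) (q : nat) : nat -> T :=
  match q with 0 => x | 1 => y | 2 => z | 3 => t | _ => fun=> d end.

Section Phases.
Variables (F : realFieldType) (sz : F -> nat) (bnd : nat -> F -> Prop).
Hypothesis sb : size_bound sz bnd.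
Variables (W m b : nat).
Hypotheses (m_lt_W : (m < W)%N) (m_gt0 : (0 < m)%N) (b_le_m : (b <= m)%N).
Variable w : nat -> F.
Hypothesis bnd_psave : forall k, (k <= b)%N -> bnd W (psave b w k).
Hypothesis bnd_cutpos_val : forall i k, (i < m)%N -> (k < b)%N ->
  bnd W ((cut m b w i - psave b w k) / (psave b w k.+1 - psave b w k)).
Hypothesis bnd_collen : forall j, (j < m)%N -> bnd W (collen m b w j).

Local Notation S := (psave b w).
Local Notation models := (models m b).
Local Notation triple := (hoare sz bnd W m).
Local Notation z0 := (fun=> 0 : F).
Local Notation n0 := (fun _ _ => 0%N).

Let W0 : (0 < W)%N. Proof. exact: leq_ltn_trans m_lt_W. Qed.

Lemma bnd0 : bnd W 0.
Proof. by apply: (bnd_homo sb) (bnd_nat sb 0); exact: W0. Qed.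

Lemma bnd1 : bnd W 1.
Proof. by apply: (bnd_homo sb) (bnd_nat sb 1); exact: W0. Qed.

Definition psave_config k := Config 0
  (layout 0 w (fun i => if (i <= k)%N then S i else 0) z0 z0) n0.

Section EvalSpec.
Variables (g : config F) (c : seq nat) (s : state F).
Hypothesis hs : models g c s.

Lemma eval_next e k : ieval s e = k -> ieval s (succ_exp e) = k.+1.
Proof. by move=> /= ->; rewrite addn1. Qed.

Lemma eval_arr_at q e k : ieval s e = k -> (k <= m)%N -> feval s (arr q e) = carr g q k.
Proof. by move=> <-; apply: eval_arr hs _ _. Qed.

Hypothesis carr1 : forall k, (k <= b)%N -> carr g 1 k = S k.

Lemma eval_psave e k : ieval s e = k -> (k <= b)%N -> feval s (arr 1 e) = S k.
Proof.
by move=> ek kb; rewrite (eval_arr_at _ ek) ?carr1 // (leq_trans kb).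
Qed.

Lemma eval_step e k : ieval s e = k -> (k < b)%N ->
  feval s (FSub (arr 1 (succ_exp e)) (arr 1 e)) = S k.+1 - S k.
Proof.
move=> ek kb; rewrite -(eval_psave (eval_next ek) kb).
by rewrite -(eval_psave ek (ltnW kb)).
Qed.

Hypothesis csoloE : csolo g = nsolo m b w.

Lemma eval_cut e i : ieval s e = i -> feval s (cut_exp e) = cut m b w i.
Proof.
move=> ei; set r := nsolo m b w.
have er : ieval s numSolo = r by rewrite (eval_solo hs).
have eb := eval_bikes hs; have em := eval_agents hs.
have esub : ieval s (ISub e numSolo) = (i - r)%N by rewrite -ei -er.
have eS : ieval s (ISub e (ISub e numSolo)) = (i - (i - r))%N by rewrite -esub -ei.
have le_b : (i - (i - r) <= b)%N by have : (r <= b)%N := nsolo_le m b w; lia.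
rewrite /cut -(eval_psave eS le_b) -(eval_psave eb) // -(eval_psave er) ?nsolo_le //.
by rewrite -/r -esub -er -em.
Qed.

Lemma eval_pt (e e' : iexp) k j : ieval s e = k -> ieval s e' = j -> (k < b)%N ->
  (j <= m)%N -> carr g 3 j = brk m b w j ->
  feval s (pt_exp e e') = pt m b w k j.
Proof.
move=> ek ej kb jm e3; rewrite /pt -(eval_step ek kb).
by rewrite -e3 -(eval_arr_at _ ej jm) -(eval_psave ek (ltnW kb)).
Qed.
End EvalSpec.

Lemma compute_psave_ok :
  triple (models (psave_config 0) [::]) compute_psave (models (psave_config b) [::]).
Proof.
apply: (triple_for sb m_lt_W m_gt0 b_le_m (c := [::]) (K := psave_config) b_le_m).
  by move=> k c s /eval_bikes.
move=> k kb; have km := leq_trans kb b_le_m.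
apply: (triple_fset sb m_lt_W (q := 1) (i := k.+1) (v := S k.+1)) => //.
- move=> s hs; rewrite (eval_cell hs); congr addn; apply: eval_next.
  by rewrite (eval_ctr hs).
- move=> s hs; have ek : ieval s (ctr 0) = k by rewrite (eval_ctr hs).
  rewrite psaveS.
  have -> : S k = feval s (arr 1 (ctr 0)).
    by rewrite (eval_arr_at hs 1 ek (ltnW km)) /= leqnn.
  have e0 : ieval s (ISub (ISub numBikes (ICst 1)) (ctr 0)) = (b - 1 - k)%N.
    by rewrite -(eval_bikes hs) -ek.
  have -> : save b w k = 1 - feval s (arr 0 (ISub (ISub numBikes (ICst 1)) (ctr 0))).
    by rewrite (eval_arr_at hs 0 e0) //; lia.
  by [].
- exact: bnd_psave.
move=> [|[|[|[|q]]]] i im //=; case: (ltngtP i k.+1) => h.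
- by rewrite -ltnS h.
- by rewrite leqNgt (ltnW h).
- by rewrite h.
Qed.

Definition full_psave i := if (i <= b)%N then S i else 0.

Definition solo_cond k :=
  ~~ (S b - S k <= (S k.+1 - S k) * (m - k)%:R).

Definition nsolo_config k := Config (last_val k solo_cond succn 0%N)
  (layout 0 w full_psave z0 z0) n0.

Lemma compute_nsolo_ok :
  triple (models (nsolo_config 0) [::]) compute_nsolo (models (nsolo_config b) [::]).
Proof.
apply: (triple_for sb m_lt_W m_gt0 b_le_m (c := [::]) (K := nsolo_config) b_le_m).
  by move=> k c s /eval_bikes.
move=> k kb; have km := leq_trans kb b_le_m.
apply: (hoare_if sb W0 (v := solo_cond k)) => [s hs|].
  have h1 i : (i <= b)%N -> carr (nsolo_config k) 1 i = S i.
    by rewrite /= /full_psave => ->.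
  have ek : ieval s (ctr 0) = k by rewrite (eval_ctr hs).
  rewrite /solo_cond -(eval_step hs h1 ek kb) -(eval_psave hs h1 ek (ltnW kb)).
  by rewrite -(eval_psave hs h1 (eval_bikes hs)) // -(eval_agents hs) -ek.
case: ifP => hc.
  apply: (triple_rset sz m_lt_W m_gt0 b_le_m (v := k.+1)) => // [s hs|].
    by apply: eval_next; rewrite (eval_ctr hs).
  by rewrite /= hc.
by apply: (triple_skip sz m_lt_W); split=> //=; rewrite hc.
Qed.

Definition cutpos_cond i k := (S k <= cut m b w i) && ~~ (S k.+1 <= cut m b w i).
Definition cutpos_val i k := (cut m b w i - S k) / (S k.+1 - S k).

(** Memory in outer round [i] after [k] inner rounds; the entry in progress is an unfinished
    [last_val]. *)
Definition cutpos_config' i k := Config (nsolo m b w)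
  (layout 0 w full_psave
     (fun l => if (l < i)%N then cutpos m b w l else
               if l == i then last_val k (cutpos_cond i) (cutpos_val i) 0 else 0)
     z0) n0.

Definition cutpos_config i := Config (nsolo m b w)
  (layout 0 w full_psave (fun l => if (l < i)%N then cutpos m b w l else 0) z0) n0.

Lemma compute_cutpos_ok :
  triple (models (cutpos_config 0) [::]) compute_cutpos (models (cutpos_config m) [::]).
Proof.
apply: (triple_for sb m_lt_W m_gt0 b_le_m (c := [::]) (K := cutpos_config) (leqnn m)).
  by move=> k c s /eval_agents.
move=> i im.
apply: (triple_same (g1 := cutpos_config' i 0) (g2 := cutpos_config' i b)).
- split=> // -[|[|[|[|q]]]] l lm //=.
  by case: ltnP => // _; case: eqP.
- split=> // -[|[|[|[|q]]]] l lm //=; rewrite ltnS leq_eqVlt.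
  by case: (ltngtP l i) => // ->.
apply: (triple_for sb m_lt_W m_gt0 b_le_m (c := [:: i]) (K := cutpos_config' i) b_le_m).
  by move=> k c s /eval_bikes.
move=> k kb; have km := leq_trans kb b_le_m.
have h1 l : (l <= b)%N -> carr (cutpos_config' i k) 1 l = S l.
  by rewrite /= /full_psave => ->.
apply: (hoare_if sb W0 (v := cutpos_cond i k)) => [s hs|].
  have ei : ieval s (ctr 0) = i by rewrite (eval_ctr hs).
  have ek : ieval s (ctr 1) = k by rewrite (eval_ctr hs).
  rewrite /cutpos_cond -(eval_cut hs h1 erefl ei).
  by rewrite -(eval_psave hs h1 ek (ltnW kb)) -(eval_psave hs h1 (eval_next ek)).
case: ifP => hc; last first.
  apply: (triple_skip sz m_lt_W); split=> // -[|[|[|[|q]]]] l lm //=.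
  by rewrite hc.
apply: (triple_fset sb m_lt_W (q := 2) (i := i) (v := cutpos_val i k)) => //.
- exact: ltnW.
- by move=> s hs; rewrite (eval_cell hs) (eval_ctr hs).
- move=> s hs; have ei : ieval s (ctr 0) = i by rewrite (eval_ctr hs).
  have ek : ieval s (ctr 1) = k by rewrite (eval_ctr hs).
  rewrite /cutpos_val -(eval_step hs h1 ek kb) -(eval_cut hs h1 erefl ei).
  by rewrite -(eval_psave hs h1 ek (ltnW kb)).
- exact: bnd_cutpos_val.
- move=> [|[|[|[|q]]]] l lm //=; rewrite hc.
  by case: (ltngtP l i).
Qed.

Lemma bnd_cutpos i : (i < m)%N -> bnd W (cutpos m b w i).
Proof.
move=> im; rewrite /cutpos; case: last_valP => [k kb _ _|_]; last exact: bnd0.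
exact: bnd_cutpos_val.
Qed.

Definition full_cutpos i := if (i < m)%N then cutpos m b w i else 0.

Local Notation bfe := (brk_from_end m b w).

Definition brk_config' t n := Config (nsolo m b w)
  (layout 0 w full_psave full_cutpos
     (fun j => if (m - j <= t)%N then bfe (m - j) else
               if (m - j)%N == t.+1 then max_below m b w (bfe t) n else 0)) n0.

Definition brk_config t := Config (nsolo m b w)
  (layout 0 w full_psave full_cutpos
     (fun j => if (m - j <= t)%N then bfe (m - j) else 0)) n0.

Definition brk_cond t n :=
  ~~ (bfe t <= cutpos m b w n) && ~~ (cutpos m b w n <= max_below m b w (bfe t) n).

Lemma compute_brk_ok :
  triple (models (cutpos_config m) [::]) compute_brk (models (brk_config m) [::]).
Proof.
apply: (hoare_seq (Q := models (brk_config 0) [::])).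
  apply: (triple_fset sb m_lt_W (q := 3) (i := m) (v := 1)) => //.
  - by move=> s hs; rewrite (eval_cell hs) (eval_agents hs).
  - exact: bnd1.
  - move=> [|[|[|[|q]]]] l lm //=; rewrite leqn0 subn_eq0.
    by case: (ltngtP l m) lm => // -> _; rewrite subnn.
apply: (triple_for sb m_lt_W m_gt0 b_le_m (c := [::]) (K := brk_config) (leqnn m)).
  by move=> k c s /eval_agents.
move=> t tm.
apply: (triple_same (g1 := brk_config' t 0) (g2 := brk_config' t m)).
- split=> // -[|[|[|[|q]]]] l lm //=.
  by case: ifP => // _; case: eqP.
- split=> // -[|[|[|[|q]]]] l lm //=.
  rewrite [(m - l <= t.+1)%N]leq_eqVlt ltnS; case: eqP => [->|_ /=]; first by rewrite ltnn.
  by [].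
apply: (triple_for sb m_lt_W m_gt0 b_le_m (c := [:: t]) (K := brk_config' t) (leqnn m)).
  by move=> k c s /eval_agents.
move=> n nm; have e_cur s : models (brk_config' t n) [:: t; n] s ->
    ieval s (ISub numAgents (succ_exp (ctr 0))) = (m - t.+1)%N.
  move=> hs; have et : ieval s (ctr 0) = t by rewrite (eval_ctr hs).
  by rewrite -(eval_next et) -[in RHS](eval_agents hs).
have c2 : carr (brk_config' t n) 2 n = cutpos m b w n by rewrite /= /full_cutpos nm.
have c3 : carr (brk_config' t n) 3 (m - t.+1) = max_below m b w (bfe t) n.
  by rewrite /= subKn // ltnn eqxx.
apply: (hoare_if sb W0 (v := brk_cond t n)) => [s hs|].
  have en : ieval s (ctr 1) = n by rewrite (eval_ctr hs).
  have eq : ieval s (ISub numAgents (ctr 0)) = (m - t)%N.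
    have et : ieval s (ctr 0) = t by rewrite (eval_ctr hs).
    by rewrite -[in RHS](eval_agents hs) -et.
  have c3' : carr (brk_config' t n) 3 (m - t) = bfe t by rewrite /= subKn ?leqnn // ltnW.
  rewrite /brk_cond -c2 -(eval_arr_at hs 2 en (ltnW nm)) -c3 -c3'.
  by rewrite -(eval_arr_at hs 3 eq) ?leq_subr // -(eval_arr_at hs 3 (e_cur s hs)) ?leq_subr.
case: ifP => hc; last first.
  apply: (triple_skip sz m_lt_W); split=> // -[|[|[|[|q]]]] l lm //=.
  by move: hc; rewrite /brk_cond => ->.
apply: (triple_fset sb m_lt_W (q := 3) (i := (m - t.+1)%N) (v := cutpos m b w n)) => //.
- exact: leq_subr.
- by move=> s hs; rewrite (eval_cell hs) e_cur.
- move=> s hs; have en : ieval s (ctr 1) = n by rewrite (eval_ctr hs).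
  by rewrite (eval_arr_at hs 2 en) // ltnW.
- exact: bnd_cutpos.
move=> [|[|[|[|q]]]] l lm //=; move: hc; rewrite /brk_cond => ->.
have -> : (l == m - t.+1)%N = (m - l == t.+1)%N by lia.
by rewrite -[(m - l <= t)%N]ltnS; case: ltngtP.
Qed.

Definition full_brk j := if (j <= m)%N then brk m b w j else 0.

Definition bikes_config (M : nat -> nat -> nat) := Config (nsolo m b w)
  (layout 0 w full_psave full_cutpos full_brk) M.

Definition bike_cond i j k :=
  (cut m b w i <= pt m b w k j) && ~~ (cut m b w i.+1 <= pt m b w k j).

Definition partial_mat i j (x : nat) (i' j' : nat) : nat :=
  if (i' < i)%N || (i' == i) && (j' < j)%N then bike_at m b w i' j' else
  if (i' == i) && (j' == j) then x else 0%N.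

Lemma compute_bikes_ok :
  triple (models (brk_config m) [::]) compute_bikes
    (models (bikes_config (bike_at m b w)) [::]).
Proof.
apply: (triple_same (g1 := bikes_config (partial_mat 0 0 0))
                    (g2 := bikes_config (partial_mat m 0 0))).
- split=> // [[|[|[|[|q]]]] l lm //=|i j im jm].
    by rewrite leq_subr /full_brk lm.
  by rewrite /= /partial_mat /= andbF; case: ifP.
- by split=> // i j im jm; rewrite /= /partial_mat im.
apply: (triple_for sb m_lt_W m_gt0 b_le_m (c := [::])
  (K := fun i => bikes_config (partial_mat i 0 0)) (leqnn m)).
  by move=> k c s /eval_agents.
move=> i im.
apply: (triple_same (g1 := bikes_config (partial_mat i 0 0))
                    (g2 := bikes_config (partial_mat i m 0))) => //.
  split=> // i' j' im' jm' /=; rewrite /partial_mat jm' !andbT ltnS ltn0 andbF orbF.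
  by rewrite leq_eqVlt orbC; case: ifP => // _; rewrite !if_same.
apply: (triple_for sb m_lt_W m_gt0 b_le_m (c := [:: i])
  (K := fun j => bikes_config (partial_mat i j 0)) (leqnn m)).
  by move=> k c s /eval_agents.
move=> j jm.
pose x k := last_val k (bike_cond i j) (fun k => (b - k)%N) 0%N.
apply: (triple_same (g1 := bikes_config (partial_mat i j (x 0%N)))
                    (g2 := bikes_config (partial_mat i j (x b)))) => //.
  split=> // i' j' im' jm' /=; rewrite /partial_mat ltnS [(j' <= j)%N]leq_eqVlt.
  by case: (ltngtP i' i) => //= ->; case: (ltngtP j' j) => [||->] //=; rewrite ?if_same.
apply: (triple_for sb m_lt_W m_gt0 b_le_m (c := [:: i; j])
  (K := fun k => bikes_config (partial_mat i j (x k))) b_le_m).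
  by move=> k c s /eval_bikes.
move=> k kb; set g := bikes_config _.
have h1 l : (l <= b)%N -> carr g 1 l = S l by rewrite /= /full_psave => ->.
apply: (hoare_if sb W0 (v := bike_cond i j k)) => [s hs|].
  have ei : ieval s (ctr 0) = i by rewrite (eval_ctr hs).
  have ej : ieval s (ctr 1) = j by rewrite (eval_ctr hs).
  have ek : ieval s (ctr 2) = k by rewrite (eval_ctr hs).
  rewrite /bike_cond -(eval_cut hs h1 erefl ei).
  rewrite -(eval_cut hs h1 erefl (eval_next ei)).
  rewrite -(eval_pt hs h1 ek ej kb (ltnW jm)) //=.
  by rewrite /full_brk (ltnW jm).
case: ifP => hc; last first.
  by apply: (triple_skip sz m_lt_W); split=> // i' j' im' jm' /=; rewrite /x /= hc.
apply: (triple_mset sz m_lt_W m_gt0 b_le_m (i := i) (j := j) (v := (b - k)%N)) => //.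
- move=> s hs; have ei : ieval s (ctr 0) = i by rewrite (eval_ctr hs).
  have ej : ieval s (ctr 1) = j by rewrite (eval_ctr hs).
  by rewrite -[in RHS](eval_agents hs) -ei -ej.
- move=> s hs; have ek : ieval s (ctr 2) = k by rewrite (eval_ctr hs).
  by rewrite -[in RHS](eval_bikes hs) -ek.
- by lia.
- move=> i' j' im' jm' /=; rewrite /partial_mat /x /= hc.
  case: (ltngtP i' i) => //= ->; by case: (ltngtP j' j).
Qed.

Definition lengths_config j := Config (nsolo m b w)
  (layout 0 (fun l => if (l < j)%N then collen m b w l else w l)
     full_psave full_cutpos full_brk) (bike_at m b w).

Lemma compute_lengths_ok :
  triple (models (bikes_config (bike_at m b w)) [::]) compute_lengths
    (models (lengths_config m) [::]).
Proof.
apply: (triple_for sb m_lt_W m_gt0 b_le_m (c := [::]) (K := lengths_config) (leqnn m)).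
  by move=> k c s /eval_agents.
move=> j jm.
apply: (triple_fset sb m_lt_W (q := 0) (i := j) (v := collen m b w j)) => //.
- exact: ltnW.
- by move=> s hs; rewrite (eval_cell hs) (eval_ctr hs).
- move=> s hs; have ej : ieval s (ctr 0) = j by rewrite (eval_ctr hs).
  have c3 l : (l <= m)%N -> brk m b w l = carr (lengths_config j) 3 l.
    by rewrite /= /full_brk => ->.
  rewrite /collen !c3 // ?(ltnW jm) //.
  by rewrite -(eval_arr_at hs 3 ej (ltnW jm)) -(eval_arr_at hs 3 (eval_next ej) jm).
- exact: bnd_collen.
- move=> [|[|[|[|q]]]] l lm //=; rewrite ltnS leq_eqVlt.
  by case: (ltngtP l j) => // ->.
Qed.
End Phases.

(** * Size bounds *)

Section SizeBounds.
Variables (F : realFieldType) (sz : F -> nat) (bnd : nat -> F -> Prop).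
Hypothesis sb : size_bound sz bnd.
Variables (m b : nat) (u : b.-tuple F).
Hypotheses (m_gt0 : (0 < m)%N) (b_le_m : (b <= m)%N) (u_ok : valid_speeds u).

Let w := nth 0 u.
Let N := input_size sz m u.

Lemma m_le_input_size : (m <= N)%N.
Proof. exact: leq_addr. Qed.

Lemma bnd_small n : (n <= m)%N -> bnd (N + 1) n%:R.
Proof.
move=> nm; apply: (bnd_homo sb) (bnd_nat sb n).
by rewrite addn1 (leq_trans (nat_bits_leS n)) // ltnS (leq_trans nm) ?m_le_input_size.
Qed.

Lemma bnd_psave k : (k <= b)%N -> bnd (3 * N + 1) (psave b w k).
Proof.
(* Per term, the constant 1 and two operations add 3 to the size of the input; the input sizes sum
   to at most [N], so the total stays linear. *)
move=> kb; apply: (bnd_homo sb (L := (1 + \sum_(i < k) (sz (w (b - 1 - i)) + 3))%N)).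
  rewrite addnC leq_add2r.
  apply: (@leq_trans (\sum_(i < b) (sz (w (b - 1 - i)) + 3))).
    by rewrite -(big_mkord xpredT (fun i => sz (w (b - 1 - i)) + 3)%N)
    -(big_mkord xpredT (fun i => sz (w (b - 1 - i)) + 3)%N) [leqRHS](big_cat_nat (n := k)) //= leq_addr.
  rewrite big_split /= sum_nat_const card_ord.
  have -> : \sum_(i < b) sz (w (b - 1 - i)) = \sum_(i < b) sz (tnth u i).
    rewrite [RHS](reindex_inj rev_ord_inj) /=; apply: eq_bigr => i _.
    by rewrite (tnth_nth 0) /= /w; congr (sz (nth _ _ _)); have := ltn_ord i; lia.
  by rewrite /N /input_size; set s := \sum_(i < b) _; lia.
elim: k {kb} => [|k IH]; first by rewrite psave0 big_ord0; exact: (bnd_nat sb 0).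
rewrite psaveS big_ord_recr /= addnA.
apply: (bnd_homo sb) (bndD sb IH (bndB sb (bnd_nat sb 1) (bnd_sz sb _))).
rewrite (_ : nat_bits 1 = 1%N) //.
by move: (\sum_(i < k) _) (sz _) => x y; lia.
Qed.

(** Three prefix sums of size [3 * N + 1], two small naturals of size [N + 1] and four
    operations. *)
Lemma bnd_cut i : (i <= m)%N -> bnd (11 * N + 9) (cut m b w i).
Proof.
move=> im; have mN := m_le_input_size.
have le_b : (i - (i - nsolo m b w) <= b)%N by have := nsolo_le m b w; lia.
have le1 : (i - nsolo m b w <= m)%N by lia.
have le2 : (m - nsolo m b w <= m)%N by lia.
have h := bndD sb (bnd_psave le_b) (bndV sb (bndM sb (bnd_small le1)
  (bndB sb (bnd_psave (leqnn b)) (bnd_psave (nsolo_le m b w)))) (bnd_small le2)).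
by apply: (bnd_homo sb) h; lia.
Qed.

Lemma bnd_cutpos_val i k : (i < m)%N -> (k < b)%N ->
  bnd (20 * N + 15)
    ((cut m b w i - psave b w k) / (psave b w k.+1 - psave b w k)).
Proof.
move=> im kb; have h := bndV sb (bndB sb (bnd_cut (ltnW im)) (bnd_psave (ltnW kb)))
   (bndB sb (bnd_psave kb) (bnd_psave (ltnW kb))).
by apply: (bnd_homo sb) h; lia.
Qed.

(** Break points are 0, 1 or cut positions, chosen by comparison alone, so the recursion adds
    nothing to their size. *)
Lemma bnd_brk j : bnd (20 * N + 15) (brk m b w j).
Proof.
have b0 : bnd (20 * N + 15) 0 by apply: (bnd_homo sb) (bnd_nat sb 0); rewrite addn_gt0 orbT.
have bc i : (i < m)%N -> bnd (20 * N + 15) (cutpos m b w i).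
  move=> im; rewrite /cutpos; case: last_valP => [k kb _ _|_] //.
  exact: bnd_cutpos_val.
have bm q n : (n <= m)%N -> bnd (20 * N + 15) (max_below m b w q n).
  elim: n => [|n IH] nm //=; case: ifP => _; [exact: bc | exact/IH/ltnW].
rewrite /brk; case: (m - j)%N => [|t] /=; last exact: bm.
by apply: (bnd_homo sb) (bnd_nat sb 1); rewrite addn_gt0 orbT.
Qed.

Lemma bnd_collen j : bnd (40 * N + 40) (collen m b w j).
Proof. by apply: (bnd_homo sb) (bndB sb (bnd_brk _) (bnd_brk _)); lia. Qed.

Let W := (40 * N + 40)%N.
Let m_lt_W : (m < W)%N.
Proof. by have := m_le_input_size; rewrite /W; lia. Qed.
Let W0 : (0 < W)%N. Proof. exact: leq_ltn_trans m_lt_W. Qed.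

Lemma bounded_init : bounded bnd W (init_state m u).
Proof.
have le_W n : (n <= m)%N -> (nat_bits n <= W)%N.
  by move=> nm; apply: leq_trans (nat_bits_leS n) _; apply: leq_ltn_trans nm m_lt_W.
split=> [[|[|a]]|a] /=; rewrite ?nth_nil; try exact: le_W.
have [ab|ba] := ltnP a b; last first.
  by rewrite nth_default ?size_tuple //; apply: (bnd_homo sb) (bnd_nat sb 0); exact: W0.
apply: (bnd_homo sb) (bnd_sz sb _).
have -> : nth 0 u a = tnth u (Ordinal ab) by rewrite (tnth_nth 0).
have : (sz (tnth u (Ordinal ab)) <= N)%N.
  by rewrite /N /input_size (bigD1 (Ordinal ab)) //= addnCA leq_addr.
by rewrite /W; lia.
Qed.

Local Notation triple := (hoare sz bnd W m).

Lemma save_b_ok :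
  triple (fun s => s = init_state m u) save_b
         (models m b (psave_config b w 0) [::]).
Proof.
have le_W n : (n <= m)%N -> (nat_bits n <= W)%N.
  by move=> nm; apply: leq_trans (nat_bits_leS n) _; apply: leq_ltn_trans nm m_lt_W.
apply: (hoare_seq (Q := fun s =>
  s = State (upd (nth 0%N [:: m; b]) (m * m + 1) b) (nth 0 u))).
  by apply: (hoare_iset sz m W0) => s -> /=; split=> //; exact: le_W.
apply: (hoare_iset sz m W0) => s ->; split; first exact: le_W.
split=> //=; rewrite /upd /=.
- by case: eqP => //; lia.
- split; first by case: eqP => [|_]; [nia | rewrite eqxx].
  case: eqP => [|_]; first by lia.
  case: eqP => [|_]; first by lia.
  by rewrite nth_default //= addn2.
- move=> q i im; case: q => [|q] /=; first by rewrite mul0n add0n.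
  rewrite nth_default; last by rewrite size_tuple; nia.
  case: q => [|[|[|q]]] //=.
  by case: i im => // _; rewrite psave0.
- move=> i j im jm; case: eqP => // ne; have := mat_addr im jm.
  case: eqP => [|_ h]; first by lia.
  by rewrite nth_default //=; lia.
Qed.

Lemma program_ok :
  triple (fun s => s = init_state m u) program
         (models m b (lengths_config m b w m) [::]).
Proof.
have bp k : (k <= b)%N -> bnd W (psave b w k).
  by move=> kb; apply: (bnd_homo sb) (bnd_psave kb); rewrite /W; lia.
have bv i k : (i < m)%N -> (k < b)%N ->
    bnd W ((cut m b w i - psave b w k) / (psave b w k.+1 - psave b w k)).
  by move=> im kb; apply: (bnd_homo sb) (bnd_cutpos_val im kb); rewrite /W; lia.
apply: hoare_seq save_b_ok _.
apply: hoare_seq (compute_psave_ok sb m_lt_W m_gt0 b_le_m bp) _.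
apply: (hoare_seq (Q := models m b (cutpos_config m b w 0) [::])).
  apply: (triple_same (g1 := nsolo_config m b w 0) (g2 := nsolo_config m b w b)) => //.
  exact: compute_nsolo_ok.
apply: (hoare_seq (Q := models m b (cutpos_config m b w m) [::])).
  exact: compute_cutpos_ok.
apply: (hoare_seq (Q := models m b (brk_config m b w m) [::])).
  exact: compute_brk_ok.
apply: (hoare_seq (Q := models m b (bikes_config m b w (bike_at m b w)) [::])).
  exact: compute_bikes_ok.
by apply: compute_lengths_ok => // j _; exact: bnd_collen.
Qed.
End SizeBounds.

(** * Polynomial running time in the two cost models *)

Definition time_bound : {poly nat} :=
  cmd_weight program * (40%N%:P * 'X + 40%N%:P) + 'X * 'X.

Lemma program_solves (F R : realFieldType) (sz : F -> nat) (bnd : nat -> F -> Prop)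
    (f : {rmorphism F -> R}) (m b : nat) (u : b.-tuple F) :
  size_bound sz bnd -> {mono f : x y / x <= y} -> (0 < m)%N -> (b <= m)%N ->
  valid_speeds u -> solves_within sz f program time_bound m u.
Proof.
move=> sb f_mono m_gt0 b_le_m u_ok.
have [t [s [ex ht _ hs]]] :=
  program_ok sb m_gt0 b_le_m (bounded_init sb u m_gt0 b_le_m) erefl.
exists t, s, (map_schedule f (wrap_schedule m b (nth 0 u))).
have [h1 _ _ h4 h5] := hs.
split=> //; last exact: wrap_optimal.
- have mN := m_le_input_size sz m u.
  rewrite /time_bound; move: (cmd_weight program) ht => q ht.
  rewrite !(hornerD, hornerM, hornerC, hornerX).
  (* The summand ['X * 'X] pays for the [m * m] entries of the output matrix. *)
  apply: leq_add; last exact: leq_mul.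
  apply: (leq_trans ht); apply: leq_mul; first exact: horner_nat_homo.
  exact: leqnn.
- split=> //= [i j|j].
    have w_ok := nth_speed_bounds u_ok.
    by rewrite (slab_wrap _ m_gt0 b_le_m) h5.
  by rewrite !mxE -[nat_of_ord j]add0n -(mul0n (m + 1)) h4 ?(ltnW (ltn_ord j)) //= ltn_ord.
Qed.

Lemma size_bound_unit (F : realFieldType) :
  size_bound (fun _ : F => 1%N) (fun _ _ => True).
Proof. by split=> // L x _; rewrite addn_gt0 orbT. Qed.

(** With [2 ^ L] bounding both parts, the numerator of a sum is at most [2 * 2 ^ (L + L')]; this is
    the origin of [L + L' + 1] in [size_bound]. *)
Definition rat_rep (L : nat) (q : rat) : Prop :=
  exists (n : int) (d : nat),
    [/\ (0 < d)%N, q = n%:~R / d%:R, (`|n| <= 2 ^ L)%N & (d <= 2 ^ L)%N].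

(** Cancelling a common factor only shrinks numerator and denominator, and each then takes at most
    [L + 1] bits. *)
Lemma rat_rep_bits L (q : rat) : rat_rep L q -> (rat_bits q <= 2 * L + 2)%N.
Proof.
move=> [n [d [d0 -> nL dL]]].
have -> : (d%:R : rat) = (d%:Z)%:~R by [].
have bits k : (k <= 2 ^ L)%N -> (nat_bits k <= L.+1)%N.
  by move=> kL; apply: nat_bits_le => //; rewrite (leq_ltn_trans kL) // ltn_exp2l.
rewrite -[d]absz_nat in d0 dL; rewrite /rat_bits.
case: divqP nL d0 dL => [//|k x k0]; rewrite !abszM => nL _ dL.
have k1 : (0 < `|k|)%N by rewrite absz_gt0.
have h1 := bits `|numq x|%N (leq_trans (leq_pmull _ k1) nL).
have h2 := bits `|denq x|%N (leq_trans (leq_pmull _ k1) dL).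
by lia.
Qed.

Lemma size_bound_rat : size_bound rat_bits rat_rep.
Proof.
have add_ok n n' d d' L L' : (`|n| <= 2 ^ L)%N -> (`|n'| <= 2 ^ L')%N ->
    (d <= 2 ^ L)%N -> (d' <= 2 ^ L')%N ->
    (`|(n * d'%:Z + n' * d%:Z)%R| <= 2 ^ (L + L' + 1))%N.
  move=> h1 h2 h3 h4; apply: (@leq_trans (`|n| * d' + `|n'| * d)).
    have : (`|(n * d'%:Z + n' * d%:Z)%R| <= `|(n * d'%:Z)%R| + `|(n' * d%:Z)%R|)%N.
      by rewrite -lez_nat PoszD !abszE ler_normD.
    by rewrite !abszM !absz_nat.
  rewrite expnD expn1 expnD muln2 -addnn.
  by apply: leq_add; [exact: leq_mul | rewrite mulnC leq_mul].
have mul_ok k k' L L' : (k <= 2 ^ L)%N -> (k' <= 2 ^ L')%N ->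
    (k * k' <= 2 ^ (L + L' + 1))%N.
  move=> h1 h2; apply: (@leq_trans (2 ^ (L + L'))); first by rewrite expnD leq_mul.
  by rewrite leq_exp2l ?leq_addr.
have nz d : (0 < d)%N -> (d%:R : rat) != 0 by rewrite pnatr_eq0 -lt0n.
split.
- move=> L L' q LL [n [d [d0 e nL dL]]]; exists n, d; split=> //.
    by apply: leq_trans nL _; rewrite leq_exp2l.
  by apply: leq_trans dL _; rewrite leq_exp2l.
- move=> n; exists n%:Z, 1%N; split=> //; first by rewrite divr1.
    by apply/ltnW/ltn_nat_bits.
  by rewrite expn_gt0.
- move=> L L' _ _ [n [d [d0 -> nL dL]]] [n' [d' [d0' -> nL' dL']]].
  exists (n * d'%:Z + n' * d%:Z), (d * d')%N; split=> //.
  + by rewrite muln_gt0 d0.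
  + by rewrite addf_div ?nz // natrM rmorphD !rmorphM.
  + exact: add_ok.
  + exact: mul_ok.
- move=> L L' _ _ [n [d [d0 -> nL dL]]] [n' [d' [d0' -> nL' dL']]].
  exists (n * d'%:Z + (- n') * d%:Z), (d * d')%N; split=> //.
  + by rewrite muln_gt0 d0.
  + by rewrite -mulNr addf_div ?nz // natrM rmorphD !rmorphM rmorphN.
  + by apply: add_ok => //; rewrite abszN.
  + exact: mul_ok.
- move=> L L' _ _ [n [d [d0 -> nL dL]]] [n' [d' [d0' -> nL' dL']]].
  exists (n * n'), (d * d')%N; split=> //.
  + by rewrite muln_gt0 d0.
  + by rewrite mulf_div natrM rmorphM.
  + by rewrite abszM mul_ok.
  + exact: mul_ok.
- move=> L L' _ _ [n [d [d0 -> nL dL]]] [n' [d' [d0' -> nL' dL']]].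
  have [->|n0] := eqVneq n' 0.
    exists 0, 1%N; split=> //; first by rewrite !mul0r invr0 mulr0.
    by rewrite expn_gt0.
  (* The sign of the divisor moves to the numerator, so that the denominator is a positive natural
     number. *)
  exists (n * d'%:Z * Num.sg n'), (d * `|n'|)%N; split=> //.
  + by rewrite muln_gt0 d0 absz_gt0.
  + have -> : ((d * `|n'|)%N%:R : rat) = d%:R * ((Num.sg n')%:~R * n'%:~R).
      by rewrite natrM -intrM -normrEsg -abszE.
    have sn0 : ((Num.sg n')%:~R : rat) != 0 by rewrite intr_eq0 sgr_eq0.
    have nn0 : (n'%:~R : rat) != 0 by rewrite intr_eq0.
    rewrite !rmorphM; have := nz d d0; have := nz d' d0'.
    by move=> h1 h2; field; rewrite h1 h2 sn0 nn0.
  + by rewrite !abszM absz_sg n0 muln1 mul_ok.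
  + exact: mul_ok.
- exact: rat_rep_bits.
move=> q; exists (numq q), `|denq q|%N; split=> //.
- by rewrite absz_gt0 denq_eq0.
- by rewrite [in RHS]pmulrn absz_denq divq_num_den.
- apply/ltnW/(leq_trans (ltn_nat_bits _)).
  by rewrite leq_exp2l // leq_addr.
- apply/ltnW/(leq_trans (ltn_nat_bits _)).
  by rewrite leq_exp2l // leq_addl.
Qed.

(* One program works for all inputs: in polynomial time on the real RAM for
   arbitrary real inverse speeds, and in polynomial bit complexity when the
   inverse speeds are rational. *)
Theorem theorem1 :
  exists (P : cmd) (p : {poly nat}),
    forall (R : realType) (m b : nat), (1 <= m)%N -> (b <= m)%N ->
      (forall u : b.-tuple R, valid_speeds u ->
         solves_within (fun _ : R => 1%N) (fun x : R => x) P p m u) /\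
      (forall u : b.-tuple rat, valid_speeds u ->
         solves_within rat_bits (fun q : rat => ratr q : R) P p m u).
Proof.
exists program, time_bound => R m b m_gt0 b_le_m; split=> u u_ok.
  exact: (@program_solves R R _ _ idfun m b u (size_bound_unit R) (fun _ _ => erefl)).
exact: (@program_solves rat R _ _ ratr m b u size_bound_rat (ler_rat R)).
Qed.
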